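(* Let $F_2$ be the free group on two generators. There exist infinitely many characteristic subgroups $N$ of $F_2$ such that $F_2/N$ is a finite simple group. In particular, the statement ''$F_n$ has no characteristic subgroup $N$ of finite index for which $F_n/N$ is a finite simple group'' (the baby Wiegold conjecture for $F_n$) fails for $n=2$.
   Context: A subgroup $N$ of a group $F$ is characteristic if $\alpha(N)=N$ for every $\alpha\in\operatorname{Aut}(F)$. $F_n$ denotes the free group on $n$ generators. *)

(* Defs.v *)
From HB Require Import structures.
From mathcomp Require Import all_boot all_fingroup all_solvable generic_quotient.
From mathcomp Require Import boolp classical_sets functions cardinality.

Set Implicit Arguments.
Unset Strict Implicit.
Unset Printing Implicit Defensive.

Local Open Scope group_scope.
Local Open Scope classical_set_scope.
Local Open Scope quotient_scope.

Lemma mult1 (G H : groupType) (g : {multiplicative G -> H}) : g 1 = 1.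
Proof. by apply: (@mulgI _ (g 1)); rewrite -gmulfM !mulg1. Qed.

Lemma multV (G H : groupType) (g : {multiplicative G -> H}) x :
  g x^-1 = (g x)^-1.
Proof. by apply: (@mulgI _ (g x)); rewrite -gmulfM !mulgV mult1. Qed.

Section FreeGroup.
Variable T : choiceType.

(* The letter (x, false) stands for the generator x, and (x, true) for its
   inverse. *)
Definition letter : Type := (T * bool)%type.
Definition letter_inv (a : letter) : letter := (a.1, ~~ a.2).

Definition reduced (w : seq letter) : bool :=
  sorted (fun a b => b != letter_inv a) w.

(* The free group on T, as the set of freely reduced words. *)
Record free_group := FreeGroup { free_word :> seq letter; _ : reduced free_word }.

HB.instance Definition _ := [isSub for free_word].
HB.instance Definition _ := [Choice of free_group by <:].

(* The reduced form of a :: w, when w is reduced. *)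
Definition push (a : letter) (w : seq letter) : seq letter :=
  if w is b :: w' then if b == letter_inv a then w' else a :: w else [:: a].

Definition word_mul (u v : seq letter) : seq letter := foldr push v u.
Definition word_inv (u : seq letter) : seq letter := rev (map letter_inv u).

Lemma letter_invK : involutive letter_inv.
Proof. by case=> x b; rewrite /letter_inv /= negbK. Qed.

Lemma reduced_tl a w : reduced (a :: w) -> reduced w.
Proof. exact: path_sorted. Qed.

Lemma reduced_push a w : reduced w -> reduced (push a w).
Proof.
case: w => [//|b w] /= rw; case: ifPn => [_|nab]; first exact: reduced_tl rw.
by rewrite /reduced /= nab.
Qed.

Lemma reduced_mul u v : reduced v -> reduced (word_mul u v).
Proof. by move=> rv; elim: u => //= a u IHu; apply: reduced_push. Qed.

Lemma reduced_inv u : reduced u -> reduced (word_inv u).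
Proof.
rewrite /reduced /word_inv rev_sorted sorted_map; apply: sub_sorted => a b /=.
by apply: contraNN => /eqP/(can_inj letter_invK) ->; rewrite letter_invK.
Qed.

Lemma pushK a w : reduced w -> push (letter_inv a) (push a w) = w.
Proof.
case: w => [|b w] rw /=; first by rewrite letter_invK eqxx.
case: (altP (b =P _)) => [eb|_] /=; last by rewrite letter_invK eqxx.
case: w rw => [|c w] /=; first by rewrite -eb.
by rewrite -eb /reduced /= => /andP[/negPf -> _].
Qed.

Lemma pushVK a w : reduced w -> push a (push (letter_inv a) w) = w.
Proof. by move=> rw; have := pushK (letter_inv a) rw; rewrite letter_invK. Qed.

Lemma word_mul_push a w v :
  reduced v -> word_mul (push a w) v = push a (word_mul w v).
Proof.
move=> rv; case: w => [//|b w] /=.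
by case: eqP => //= ->; rewrite pushVK // reduced_mul.
Qed.

Lemma word_mulA u v w :
  reduced w -> word_mul u (word_mul v w) = word_mul (word_mul u v) w.
Proof. by move=> rw; elim: u => //= a u ->; rewrite word_mul_push. Qed.

Lemma word_mul1 u : reduced u -> word_mul u [::] = u.
Proof.
elim: u => //= a u IHu rau; rewrite IHu ?(reduced_tl rau) //.
by case: u {IHu} rau => //= b u /andP[/negPf ->].
Qed.

Lemma word_mulV u : word_mul (word_inv u) u = [::].
Proof.
elim: u => // a u IHu; rewrite /word_inv /= rev_cons -cats1 /word_mul foldr_cat.
by rewrite /= letter_invK eqxx.
Qed.

Lemma word_invK : involutive word_inv.
Proof. by move=> u; rewrite /word_inv map_rev revK (mapK letter_invK). Qed.

Definition free_one : free_group := @FreeGroup [::] isT.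
Definition free_mul (u v : free_group) : free_group :=
  FreeGroup (reduced_mul u (valP v)).
Definition free_inv (u : free_group) : free_group :=
  FreeGroup (reduced_inv (valP u)).

Lemma free_mulA : associative free_mul.
Proof. by move=> u v w; apply/val_inj/word_mulA/valP. Qed.
Lemma free_mul1g : left_id free_one free_mul.
Proof. by move=> u; apply: val_inj. Qed.
Lemma free_mulg1 : right_id free_one free_mul.
Proof. by move=> u; apply/val_inj/word_mul1/valP. Qed.
Lemma free_mulVg : left_inverse free_one free_inv free_mul.
Proof. by move=> u; apply/val_inj/word_mulV. Qed.
Lemma free_mulgV : right_inverse free_one free_inv free_mul.
Proof.
move=> u; apply: val_inj; rewrite /= -[X in word_mul X]word_invK.
exact: word_mulV.
Qed.

HB.instance Definition _ := isGroup.Build free_group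
  free_mulA free_mul1g free_mulg1 free_mulVg free_mulgV.

Definition free_gen (x : T) : free_group := @FreeGroup [:: (x, false)] isT.

Section Lift.
Variables (H : groupType) (f : T -> H).

Definition letter_lift (a : letter) : H := if a.2 then (f a.1)^-1 else f a.1.
Definition word_lift (w : seq letter) : H := \prod_(a <- w) letter_lift a.
Definition free_lift (u : free_group) : H := word_lift u.

Lemma letter_lift_inv a : letter_lift (letter_inv a) = (letter_lift a)^-1.
Proof. by case: a => x [] //=; rewrite /letter_lift /= ?invgK. Qed.

Lemma word_lift_push a w : word_lift (push a w) = letter_lift a * word_lift w.
Proof.
rewrite /word_lift; case: w => [|b w] /=; first by rewrite big_cons.
case: eqP => [->|_]; last by rewrite big_cons.
by rewrite big_cons letter_lift_inv mulVKg.
Qed.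

Lemma free_liftM : {morph free_lift : u v / u * v}.
Proof.
move=> u v; rewrite /free_lift /=; elim: (val u) => /= [|a w IHw].
  by rewrite /word_lift big_nil mul1g.
by rewrite word_lift_push IHw /word_lift big_cons mulgA.
Qed.

HB.instance Definition _ := isMultiplicative.Build _ _ free_lift free_liftM.

End Lift.

Lemma free_liftE (H : groupType) (f : T -> H) x :
  free_lift f (free_gen x) = f x.
Proof. by rewrite /free_lift /word_lift /= big_seq1. Qed.

Lemma free_lift_uniq (H : groupType) (g h : {multiplicative free_group -> H}) :
  (forall x, g (free_gen x) = h (free_gen x)) -> g =1 h.
Proof.
move=> gh; case; elim=> [|a w IHw] raw.
  have -> : FreeGroup raw = 1 by apply: val_inj.
  by rewrite !mult1.
have rw := reduced_tl raw.
pose ga : free_group := if a.2 then (free_gen a.1)^-1 else free_gen a.1.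
have -> : FreeGroup raw = ga * FreeGroup rw.
  have ga_a : val ga = [:: a] by rewrite /ga; case: (a) => x [].
  apply: val_inj; rewrite [RHS]/= /word_mul -[free_word ga]/(val ga) ga_a /=.
  by case: (w) raw => //= b w' /andP[/negPf ->].
rewrite !gmulfM IHw; congr (_ * _).
by rewrite /ga; case: (a) => x []; rewrite /= ?multV gh.
Qed.

Lemma free_group_universal (H : groupType) (f : T -> H) :
  exists2 g : {multiplicative free_group -> H},
    (forall x, g (free_gen x) = f x) &
    forall h : {multiplicative free_group -> H},
      (forall x, h (free_gen x) = f x) -> h =1 g.
Proof.
exists (free_lift f) => [|h hf]; first exact: free_liftE.
by apply: free_lift_uniq => x; rewrite hf; apply/esym/free_liftE.
Qed.

End FreeGroup.

Notation "''Free_' n" := (free_group 'I_n)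
  (at level 8, n at level 2, format "''Free_' n") : type_scope.

Definition normal_subgroup (G : groupType) (N : set G) : Prop :=
  group_closed [in N] /\ forall x y : G, N x -> N (x ^ y).

Section QuotientGroup.
Variables (G : groupType) (N : set G) (nN : normal_subgroup N).

Definition same_coset (x y : G) : bool := x^-1 * y \in N.

Lemma same_coset_equiv : equiv_class_of same_coset.
Proof.
have gN := nN.1; have [N1 _] := gN.
have NV : invg_closed [in N] := group_closedV gN.
have NM : mulg_closed [in N] := group_closedM gN.
have sym x y : same_coset x y -> same_coset y x.
  by move=> /NV; rewrite /same_coset invgM invgK.
apply: EquivClass => [x|x y|y x z].
- by rewrite /same_coset mulVg.
- by apply/idP/idP; apply: sym.
- by rewrite /same_coset => xy yz; rewrite -[z](mulVKg y) mulgA; apply: NM.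
Qed.

Canonical same_coset_rel := EquivRelPack same_coset_equiv.

(* The group G / N of left cosets; \pi x is the coset of x. *)
Definition quot_group : Type := {eq_quot same_coset_rel}.

HB.instance Definition _ := Choice.on quot_group.
HB.instance Definition _ := EqQuotient.on quot_group.

Local Notation pi := (\pi_(quot_group)%qT : G -> quot_group).

Lemma quot_piP x y : reflect (pi x = pi y) (same_coset x y).
Proof. by rewrite -[same_coset x y]/(same_coset_rel x y) -eqmodE; apply: eqP. Qed.

Definition quot_one : quot_group := pi 1.
Definition quot_inv (a : quot_group) : quot_group := pi (repr a)^-1.
Definition quot_mul (a b : quot_group) : quot_group :=
  pi (repr a * repr b).

Lemma quot_invE x : quot_inv (pi x) = pi x^-1.
Proof.
have [gN NJ] := nN; apply/quot_piP; rewrite /same_coset invgK.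
have /quot_piP : pi x = pi (repr (pi x)) by rewrite reprK.
rewrite /same_coset inE => /(NJ _ x^-1).
by rewrite conjgE invgK !mulgA mulgV mul1g inE.
Qed.

Lemma quot_mulE x y : quot_mul (pi x) (pi y) = pi (x * y).
Proof.
have [gN NJ] := nN; apply/esym/quot_piP.
set x' := repr _; set y' := repr _.
have /quot_piP xx' : pi x = pi x' by rewrite reprK.
have /quot_piP yy' : pi y = pi y' by rewrite reprK.
rewrite /same_coset.
have -> : (x * y)^-1 * (x' * y') = (x^-1 * x') ^ y * (y^-1 * y').
  by rewrite conjgE invgM !mulgA mulgK.
by apply: (group_closedM gN) => //; move: xx'; rewrite /same_coset !inE; apply: NJ.
Qed.

Lemma quot_ind (P : quot_group -> Prop) : (forall x, P (pi x)) -> forall a, P a.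
Proof. by move=> Ppi a; rewrite -[a]reprK. Qed.

Lemma quot_mulA : associative quot_mul.
Proof.
by elim/quot_ind=> x; elim/quot_ind=> y; elim/quot_ind=> z; rewrite !quot_mulE mulgA.
Qed.
Lemma quot_mul1g : left_id quot_one quot_mul.
Proof. by elim/quot_ind=> x; rewrite quot_mulE mul1g. Qed.
Lemma quot_mulg1 : right_id quot_one quot_mul.
Proof. by elim/quot_ind=> x; rewrite quot_mulE mulg1. Qed.
Lemma quot_mulVg : left_inverse quot_one quot_inv quot_mul.
Proof. by elim/quot_ind=> x; rewrite quot_invE quot_mulE mulVg. Qed.
Lemma quot_mulgV : right_inverse quot_one quot_inv quot_mul.
Proof. by elim/quot_ind=> x; rewrite quot_invE quot_mulE mulgV. Qed.

HB.instance Definition _ := isGroup.Build quot_group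
  quot_mulA quot_mul1g quot_mulg1 quot_mulVg quot_mulgV.

Definition quot_pi (x : G) : quot_group := pi x.

Lemma quot_piM : {morph quot_pi : x y / x * y}.
Proof. by move=> x y; apply/esym/quot_mulE. Qed.
HB.instance Definition _ := isMultiplicative.Build G quot_group quot_pi quot_piM.

Lemma quot_pi_surj (a : quot_group) : exists x, quot_pi x = a.
Proof. by exists (repr a); apply: reprK. Qed.

Lemma quot_pi_ker x : quot_pi x = 1 <-> N x.
Proof.
rewrite -[1]/(quot_pi 1); split=> [/esym/quot_piP|Nx].
  by rewrite /same_coset invg1 mul1g inE.
by apply/esym/quot_piP; rewrite /same_coset invg1 mul1g inE.
Qed.

End QuotientGroup.

Definition characteristic_subgroup (G : groupType) (N : set G) : Prop :=
  group_closed [in N] /\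
  forall alpha : {multiplicative G -> G}, bijective alpha -> alpha @` N = N.

Section Inner.
Variables (G : groupType) (y : G).

Definition inner (x : G) : G := x ^ y.
Lemma innerM : {morph inner : x z / x * z}.
Proof. by move=> x z; apply: conjMg. Qed.
HB.instance Definition _ := isMultiplicative.Build G G inner innerM.
Lemma inner_bij : bijective inner.
Proof. by exists (fun x => x ^ y^-1) => x; rewrite /inner ?conjgK ?conjgKV. Qed.

End Inner.

Lemma characteristic_normal (G : groupType) (N : set G) :
  characteristic_subgroup N -> normal_subgroup N.
Proof.
move=> [gN charN]; split=> // x y Nx.
by rewrite -(charN (inner y) (inner_bij y)); exists x.
Qed.

Definition finite_index (G : groupType) (N : set G) : Prop :=
  finite_set (range (fun x : G => [set x * y | y in N])).

Definition finite_simple_group (H : groupType) : Prop :=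
  exists gT : finGroupType, simple [set: gT]%SET /\
    exists f : {multiplicative H -> gT}, bijective f.

Definition baby_wiegold (n : nat) : Prop :=
  ~ exists N : set 'Free_n, exists charN : characteristic_subgroup N,
      finite_index N /\
      finite_simple_group (quot_group (characteristic_normal charN)).

(* Main.v *)
Require Import Defs.
From HB Require Import structures.
From mathcomp Require Import all_boot all_fingroup all_solvable.
From mathcomp Require Import boolp classical_sets functions cardinality.
From mathcomp Require Import ssralg zmodp matrix mxalgebra finalg finfield.
From mathcomp Require Import zify ring.

(* Inside the braid group B_4 = <s1, s2, s3> the elements a = s1 s3^-1 and
   b = s2 a s2^-1 generate a normal subgroup, free of rank 2, on which the s_i
   act by conjugation through Nielsen moves (Dyer, Formanek, Grossman); an
   automorphism inverting all the s_i provides the orientation reversing moves.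
   Hence, for a finite group G with three elements satisfying the braid
   relations and an endomorphism theta inverting them, every Nielsen move of
   (a, b) extends to an injective endomorphism of G. By Nielsen's theorem the
   kernel of the map F_2 -> G defined by (a, b) is therefore characteristic.

   This is applied to the Burau representation over F_p at t = h^2, where
   h^2 = h + 1. It is unitary for t |-> 1/t, so that theta is an inverse
   transpose. As t + 1/t = 3, the square of s1 s2^-1 is a transvection; its
   conjugates generate SL_3(p), which is simple when p = 2 mod 3. The subgroup
   <a, b>, being normalised by the s_i, is thus the whole of SL_3(p). Infinitely
   many p qualify: a prime factor p = 2 mod 3 of 5 (n!)^2 - 1 is larger than n
   and has 5 as a square, hence contains h. *)

Set Implicit Arguments.
Unset Strict Implicit.
Unset Printing Implicit Defensive.

(** * Nielsen's theorem in rank two *)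

Fixpoint lcp (T : eqType) (s t : seq T) : nat :=
  match s, t with
  | x :: s', y :: t' => if x == y then (lcp s' t').+1 else 0
  | _, _ => 0
  end.

Section CommonPrefix.
Variable T : eqType.
Implicit Types s t r : seq T.

Lemma lcpC s t : lcp s t = lcp t s.
Proof. by elim: s t => [|x s IH] [|y t] //=; rewrite IH eq_sym. Qed.

Lemma lcp_size s t : lcp s t <= size s.
Proof. by elim: s t => [|x s IH] [|y t] //=; case: ifP => // _; apply: IH. Qed.

(** The ultrametric inequality: words sharing their first m letters with [t] share them with each
    other. For reduced words this says that the Cayley tree is 0-hyperbolic. *)
Lemma lcp_trans s t r : minn (lcp s t) (lcp t r) <= lcp s r.
Proof.
elim: s t r => [|x s IH] [|y t] [|z r] //=; rewrite ?minn0 ?min0n //.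
case: (x =P y) => [->|_]; rewrite ?min0n //.
by case: ifP => // _; rewrite minnSS ltnS.
Qed.

Lemma lcp_take s m : m <= size s -> lcp (take m s) s = m.
Proof.
elim: s m => [|x s IH] [|m] //=.
by rewrite ltnS eqxx => /IH ->.
Qed.

Lemma nth_lcp x0 s t i : i < lcp s t -> nth x0 s i = nth x0 t i.
Proof.
elim: s t i => [|x s IH] [|y t] //= i.
by case: eqP => // -> ; case: i => //= i; apply: IH.
Qed.

End CommonPrefix.

(** * Word length and Gromov products in a free group *)

Section WordLength.
Variable T : choiceType.
Local Open Scope group_scope.
Implicit Types u v w : free_group T.

Lemma word_mul_cat (w z : seq (letter T)) :
  reduced (w ++ z) -> word_mul w z = w ++ z.
Proof.
elim: w => //= a w IH rawz; rewrite IH ?(reduced_tl rawz) //.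
by case: (w ++ z) rawz => //= b r /andP[/negPf ->].
Qed.

Lemma reduced_cat (c d : letter T) (w z : seq (letter T)) :
  reduced (rcons w c) -> reduced (d :: z) -> d != letter_inv c ->
  reduced (rcons w c ++ d :: z).
Proof.
rewrite /reduced; case: w => [|b w] /=; first by move=> _ -> ->.
by rewrite cat_path last_rcons /= => -> -> ->.
Qed.

(** In the product of [word_inv u] and [v] exactly the common prefix cancels, once from each factor:
    after the first difference the concatenation is reduced. *)
Lemma size_word_mulV (u v : seq (letter T)) : reduced u -> reduced v ->
  size (word_mul (word_inv u) v) + (lcp u v).*2 = size u + size v.
Proof.
elim: u v => [|a u IH] [|b v] rau rbv //; first by rewrite /= addn0.
  by rewrite word_mul1 ?reduced_inv // size_rev size_map /= !addn0.
have E : word_inv (a :: u) = rcons (word_inv u) (letter_inv a).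
  by rewrite /word_inv map_cons rev_cons.
rewrite [lcp _ _]/= eq_sym; case: eqP => [ba|/eqP ba].
  rewrite E -cats1 /word_mul foldr_cat /= letter_invK ba eqxx.
  have := IH v (reduced_tl rau) (reduced_tl rbv).
  by rewrite /word_mul; lia.
have R : reduced (rcons (word_inv u) (letter_inv a) ++ b :: v).
  by apply: reduced_cat; rewrite ?letter_invK // -E reduced_inv.
rewrite E word_mul_cat // size_cat size_rcons size_rev size_map /=; lia.
Qed.

(* [fgp] is the Gromov product based at 1 in the Cayley tree. *)
Definition flen u := size (free_word u).
Definition fgp u v := lcp (free_word u) (free_word v).
Arguments flen u%_g.
Arguments fgp u%_g v%_g.

Lemma flenVM u v : flen (u^-1 * v) + (fgp u v).*2 = flen u + flen v.
Proof. exact: size_word_mulV (valP u) (valP v). Qed.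

Lemma flenV u : flen u^-1 = flen u.
Proof. by rewrite /flen /= size_rev size_map. Qed.

Lemma flenM u v : flen (u * v) + (fgp u^-1 v).*2 = flen u + flen v.
Proof. by rewrite -(flenV u) -flenVM invgK. Qed.

Lemma flen1 : flen (1 : free_group T) = 0%N. Proof. by []. Qed.

Lemma flen_eq0 u : flen u = 0%N -> u = 1.
Proof. by move/size0nil => u0; apply: val_inj. Qed.

Lemma flen_gt0 u : u != 1 -> (0 < flen u)%N.
Proof. by apply: contraNT; rewrite -eqn0Ngt => /eqP/flen_eq0/eqP. Qed.

Lemma fgpC u v : fgp u v = fgp v u. Proof. exact: lcpC. Qed.

Lemma fgp_trans u v w : (minn (fgp u v) (fgp v w) <= fgp u w)%N.
Proof. exact: lcp_trans. Qed.

Lemma fgp_le u v : (fgp u v <= flen u)%N. Proof. exact: lcp_size. Qed.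

(* Otherwise the middle letter of u would be its own inverse, or the two middle
   letters would cancel. *)
Lemma fgpV_lt u : u != 1 -> ((fgp u u^-1).*2 < flen u)%N.
Proof.
move=> /flen_gt0; rewrite ltnNge /fgp /flen /=.
case: u => u /= ru u0; apply/negP => le.
have [a0 _] : exists a0 : letter T, true by case: u u0 {ru le} => // a; exists a.
have inv_neq (a : letter T) : a <> letter_inv a by case: a => x [].
have nthV i : (i < size u)%N ->
    nth a0 (word_inv u) i = letter_inv (nth a0 u (size u - i.+1)).
  by move=> iu; rewrite nth_rev size_map // (nth_map a0) //; lia.
have [od|ev] := boolP (odd (size u)).
  have i_lt : ((size u)./2 < lcp u (word_inv u))%N by lia.
  apply: (inv_neq (nth a0 u (size u)./2)).
  rewrite {1}(nth_lcp a0 i_lt) nthV; last by lia.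
  by congr (letter_inv (nth _ _ _)); lia.
have i_lt : ((size u)./2.-1 < lcp u (word_inv u))%N by lia.
have := nth_lcp a0 i_lt; rewrite nthV; last by lia.
have -> : (size u - (size u)./2.-1.+1 = (size u)./2.-1.+1)%N by lia.
move: ru; rewrite /reduced => /(sortedP a0)/(_ (size u)./2.-1) H E.
have /H/negP[] : ((size u)./2.-1.+1 < size u)%N by lia.
by rewrite E letter_invK.
Qed.

Lemma prefix_exists u m : (m <= flen u)%N ->
  exists2 q, flen q = m & fgp q u = m.
Proof.
move=> le; have rt : reduced (take m (free_word u)).
  by rewrite /reduced; apply: take_sorted; apply: valP.
exists (FreeGroup rt); last exact: lcp_take.
by rewrite /flen /= size_takel.
Qed.

(* If [u = q r p^-1] and [v = p q^-1] without cancellation and with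
   |p| = |q| = m, then (u v)^q = r and v^q = q^-1 p. *)
Lemma half_cancel_shorten u v m :
  flen v = m.*2 -> fgp u^-1 v = m -> fgp v^-1 u = m -> (m.*2 <= flen u)%N ->
  exists q, (flen ((u * v) ^ q) + m.*2 <= flen u)%N /\ (flen (v ^ q) <= flen v)%N.
Proof.
move=> lv cuv cvu lu.
have /prefix_exists[q lq qu] : (m <= flen u)%N by lia.
exists q; have [p pE] : exists p, p = v * q by exists (v * q).
have qv : (m <= fgp q v^-1)%N.
  have := fgp_trans q u v^-1; rewrite qu (fgpC u) cvu; lia.
have lp : flen p = m.
  have := flenVM q v^-1; rewrite -invgM flenV flenV lq lv -pE.
  have := fgp_le q v^-1; lia.
have pv : fgp p v = m.
  have := flenVM p v; rewrite {1}pE invgM mulgVK flenV lq lp lv; lia.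
have pu : (m <= fgp p u^-1)%N.
  have := fgp_trans p v u^-1; rewrite pv (fgpC v) cuv; lia.
have lup : (flen (u * p) = flen u - m)%N.
  have E : (u * p)^-1 = p^-1 * u^-1 by rewrite invgM.
  have := flenVM p u^-1; rewrite -E !flenV lp.
  have := fgp_le p u^-1; lia.
have uup : (fgp u (u * p) = flen u - m)%N.
  have := flenVM u (u * p); rewrite mulKg lp lup; lia.
have qup : (m <= fgp q (u * p))%N.
  have := fgp_trans q u (u * p); rewrite qu uup; lia.
have uvq : (u * v) ^ q = q^-1 * (u * p) by rewrite pE conjgE !mulgA.
have vq : v ^ q = q^-1 * p by rewrite pE conjgE.
have := flenVM q (u * p); have := flenVM q p.
by rewrite uvq vq lq lup lp lv; lia.
Qed.

End WordLength.

Arguments flen {T} u%_g.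
Arguments fgp {T} u%_g v%_g.

(** * Small cancellation: endomorphisms that shorten no word *)

Section SmallCancellation.
Variables (T : choiceType) (f : T -> free_group T).
Local Open Scope group_scope.
Local Notation s := (letter_lift f).

(** The strict inequality says that a letter of [s b] survives between its two neighbours, so
    cancellation never passes through a whole factor. *)
Hypothesis no_full_cancel : forall a b c, b != letter_inv a -> c != letter_inv b ->
  (fgp (s a)^-1 (s b) + fgp (s b)^-1 (s c) < flen (s b))%N.

Let letter_invN (a : letter T) : a != letter_inv a.
Proof. by case: a => t [] /=; rewrite /letter_inv xpair_eqE eqxx. Qed.

Let word_lift_cons a w : word_lift f (a :: w) = s a * word_lift f w.
Proof. by rewrite /word_lift big_cons. Qed.

(** The first clause is the invariant of the induction: the image of [b :: w] keeps a longer piece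
    of [s b] than any admissible left neighbour can cancel. The second clause counts one surviving
    letter per factor. *)
Lemma word_lift_head b w : reduced (b :: w) ->
  forall a, b != letter_inv a ->
    (fgp (s a)^-1 (s b) < fgp (word_lift f (b :: w)) (s b))%N /\
    (fgp (s a)^-1 (s b) + size w < flen (word_lift f (b :: w)))%N.
Proof.
elim: w b => [|c w IH] b rw a ab.
  have H := no_full_cancel ab (letter_invN b).
  have -> : word_lift f [:: b] = s b by rewrite /word_lift big_seq1.
  have E : fgp (s b) (s b) = flen (s b).
    by have := flenVM (s b) (s b); rewrite mulVg flen1; lia.
  by rewrite E /=; lia.
have bc : c != letter_inv b by case/andP: rw.
have [H1 H2] := IH c (reduced_tl rw) b bc.
have H := no_full_cancel ab bc.
set h := word_lift f (b :: c :: w); set g := word_lift f (c :: w) in H1 H2 *.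
(* By [H1], [g] agrees with [s c] further than [(s b)^-1] does, so the ultrametric inequality forces
   equality: the cancellation is decided by the first factor of [g]. *)
have E : fgp (s b)^-1 g = fgp (s b)^-1 (s c).
  have := fgp_trans (s b)^-1 g (s c); have := fgp_trans (s b)^-1 (s c) g.
  by rewrite (fgpC (s c)); lia.
have Ebg : s b * g = h by rewrite -word_lift_cons.
have Ehb : h^-1 * s b = g^-1 by rewrite -Ebg invgM mulgVK.
have := flenM (s b) g; rewrite Ebg E => L1.
have := flenVM h (s b); rewrite Ehb flenV => L2.
by rewrite /=; lia.
Qed.

(** The endomorphism shortens no word, so a generator in its image can only come from a single
    letter. *)
Lemma free_lift_flen (w : free_group T) : (size w <= flen (free_lift f w))%N.
Proof.
case: w => [[|a w] rw] //; rewrite /free_lift /=.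
by have [_] := word_lift_head rw (letter_invN a); lia.
Qed.

End SmallCancellation.

(** * Bases of the free group of rank two *)

Section NielsenRank2.
Local Open Scope group_scope.

Definition free_x : 'Free_2 := free_gen ord0.
Definition free_y : 'Free_2 := free_gen ord_max.

Definition pair_fun (A : Type) (u v : A) : 'I_2 -> A :=
  fun i => if i == ord0 then u else v.

Lemma free_lift_x (H : groupType) (u v : H) : free_lift (pair_fun u v) free_x = u.
Proof. by rewrite free_liftE. Qed.

Lemma free_lift_y (H : groupType) (u v : H) : free_lift (pair_fun u v) free_y = v.
Proof. by rewrite free_liftE. Qed.

Lemma free2_eq (H : groupType) (g h : {multiplicative 'Free_2 -> H}) :
  g free_x = h free_x -> g free_y = h free_y -> g =1 h.
Proof.
move=> gx gy; apply: free_lift_uniq => i.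
have [->|->] // : i = ord0 \/ i = ord_max.
by case: i => -[|[|//]] ?; [left|right]; apply: val_inj.
Qed.

Definition basis (u v : 'Free_2) : Prop :=
  exists alpha : {multiplicative 'Free_2 -> 'Free_2},
    [/\ bijective alpha, alpha free_x = u & alpha free_y = v].

(** The endomorphisms given by (u, v) and by (u', v') are mutually inverse, since both composites
    fix the two generators. *)
Lemma basis_free_lift (u v u' v' : 'Free_2) :
  free_lift (pair_fun u v) u' = free_x -> free_lift (pair_fun u v) v' = free_y ->
  free_lift (pair_fun u' v') u = free_x -> free_lift (pair_fun u' v') v = free_y ->
  basis u v.
Proof.
move=> Eu Ev Eu' Ev'; exists (free_lift (pair_fun u v)).
split; [|exact: free_lift_x|exact: free_lift_y].
have can (a b a' b' : 'Free_2) : free_lift (pair_fun a b) a' = free_x ->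
    free_lift (pair_fun a b) b' = free_y ->
    cancel (free_lift (pair_fun a' b')) (free_lift (pair_fun a b)).
  move=> Ea Eb z.
  pose g : {multiplicative 'Free_2 -> 'Free_2} :=
    free_lift (pair_fun a b) \o free_lift (pair_fun a' b').
  suff : g z = idfun z by [].
  by apply: free2_eq; rewrite /= ?free_lift_x ?free_lift_y.
by exists (free_lift (pair_fun u' v')); apply: can.
Qed.

Lemma basis_comp (alpha : {multiplicative 'Free_2 -> 'Free_2}) u v :
  bijective alpha -> basis u v -> basis (alpha u) (alpha v).
Proof.
move=> bij [beta [bijb <- <-]].
by exists (alpha \o beta); split=> //; apply: bij_comp.
Qed.

Lemma basis_swap u v : basis u v -> basis v u.
Proof.
case=> alpha [bij <- <-]; apply: basis_comp => //.
by apply: (@basis_free_lift _ _ free_y free_x); rewrite ?free_lift_x ?free_lift_y.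
Qed.

Lemma basis_inv u v : basis u v -> basis u^-1 v.
Proof.
case=> alpha [bij <- <-]; rewrite -multV; apply: basis_comp => //.
by apply: (@basis_free_lift _ _ free_x^-1 free_y);
  rewrite ?multV /= ?free_lift_x ?free_lift_y ?invgK.
Qed.

Lemma basis_mul u v : basis u v -> basis (u * v) v.
Proof.
case=> alpha [bij <- <-]; rewrite -gmulfM; apply: basis_comp => //.
by apply: (@basis_free_lift _ _ (free_x * free_y^-1) free_y);
  rewrite ?gmulfM ?multV /= ?free_lift_x ?free_lift_y ?mulgK ?mulgVK.
Qed.

Lemma basis_conj u v g : basis u v -> basis (u ^ g) (v ^ g).
Proof. by apply: (@basis_comp (inner g)); apply: inner_bij. Qed.

(** Besides the elementary Nielsen moves, simultaneous conjugation is allowed. It takes the place of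
    the well-ordering of words by which the classical proof handles half cancellation. *)
Variable P : 'Free_2 -> 'Free_2 -> Prop.
Hypotheses (Pxy : P free_x free_y)
  (Pswap : forall u v, P u v -> P v u)
  (Pinv : forall u v, P u v -> P u^-1 v)
  (Pmul : forall u v, P u v -> P (u * v) v)
  (Pconj : forall u v g, P u v -> P (u ^ g) (v ^ g)).

(** Two letters with distinct indices give one of u, u^-1 and one of v, v^-1, in either order. Each
    later inequality is thus proved once for all signs and both orders. *)
Let closed_letters (Q : 'Free_2 -> 'Free_2 -> Prop) :
  (forall u v, Q u v -> Q v u) -> (forall u v, Q u v -> Q u^-1 v) ->
  forall (u v : 'Free_2) (a b : letter 'I_2), a.1 != b.1 ->
    Q (letter_lift (pair_fun u v) a) (letter_lift (pair_fun u v) b) <-> Q u v.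
Proof.
move=> Qs Qi u v.
have QiE w z : Q w^-1 z <-> Q w z by split=> [/Qi|/Qi //]; rewrite invgK.
have QsE w z : Q w z <-> Q z w by split=> /Qs.
case=> [[[|[|//]] ?] []] [[[|[|//]] ?] []] //= _; rewrite /letter_lift /pair_fun /=;
  rewrite ?QiE // QsE ?QiE // QsE ?QiE.
Qed.

Let flen_letters (u v : 'Free_2) (a b : letter 'I_2) : a.1 != b.1 ->
  flen (letter_lift (pair_fun u v) a) + flen (letter_lift (pair_fun u v) b)
    = flen u + flen v.
Proof.
by case: a b => [[[|[|//]] ?] []] [[[|[|//]] ?] []] //= _;
  rewrite /letter_lift /pair_fun /= ?flenV // addnC.
Qed.

Let letter_eq (a b : letter 'I_2) : a.1 = b.1 -> b != letter_inv a -> a = b.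
Proof. by case: a b => [i []] [j []] /= ->; rewrite /letter_inv ?eqxx. Qed.

Let letter_neq2 (a b c : letter 'I_2) : a.1 != b.1 -> b.1 != c.1 -> a.1 = c.1.
Proof.
by case: a b c => [[[|[|//]] ?] ?] [[[|[|//]] ?] ?] [[[|[|//]] ?] ?] //= _ _;
  apply: val_inj.
Qed.

(** Induction on the total length. If P fails at (u, v), no move leads to a shorter basis, which
    yields the small cancellation condition [small]. The automorphism then shortens no word, so x
    and y are themselves images of letters: (u, v) is (x, y) up to order and inverses. *)
Lemma nielsen_rank2 u v : basis u v -> P u v.
Proof.
have [n] := ubnP (flen u + flen v); elim: n u v => // n IH u v le_n uv.
apply: contrapT => nP.
pose s : letter 'I_2 -> 'Free_2 := letter_lift (pair_fun u v).
have sV a : s (letter_inv a) = (s a)^-1 by apply: letter_lift_inv.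
have Pl a b : a.1 != b.1 -> P (s a) (s b) <-> P u v.
  exact: (closed_letters Pswap Pinv).
have Bl a b : a.1 != b.1 -> basis (s a) (s b).
  by move=> ab; apply/(closed_letters basis_swap basis_inv).
have Ll := @flen_letters u v.
have Pmul' w z : P (w * z) z -> P w z.
  move=> /Pswap/Pinv/Pswap/Pmul; rewrite mulgK.
  by move=> /Pswap/Pinv; rewrite invgK => /Pswap.
have Pconj' w z g : P (w ^ g) (z ^ g) -> P w z.
  by move=> /(Pconj g^-1); rewrite !conjgK.
have grow a b : a.1 != b.1 -> (flen (s a) <= flen (s a * s b))%N.
  move=> ab; rewrite leqNgt; apply/negP => lt; apply: nP.
  apply/(Pl _ _ ab)/Pmul'/IH; last exact/basis_mul/Bl.
  by have := Ll _ _ ab; rewrite -/s; lia.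
have half a b : a.1 != b.1 -> ((fgp (s a)^-1 (s b)).*2 <= flen (s b))%N.
  move=> ab; have := grow _ _ ab; have := flenM (s a) (s b).
  by lia.
have half' a b : a.1 != b.1 -> ((fgp (s a)^-1 (s b)).*2 <= flen (s a))%N.
  rewrite eq_sym => ab.
  have /half : (letter_inv b).1 != (letter_inv a).1 by [].
  by rewrite !sV invgK flenV fgpC.
have s1 a : s a != 1.
  apply/eqP => a1; have [b ab] : exists b : letter 'I_2, a.1 != b.1.
    by case: a {a1} => [[[|[|//]] ?] e]; [exists (ord_max, e)|exists (ord0, e)].
  have [alpha [[beta K _] ax ay]] := Bl _ _ ab.
  have : free_x = 1 by rewrite -[LHS]K ax a1 -[X in beta X](mult1 alpha) K.
  by move/(congr1 (@flen _)).
have small a b c : b != letter_inv a -> c != letter_inv b ->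
    (fgp (s a)^-1 (s b) + fgp (s b)^-1 (s c) < flen (s b))%N.
  have [eab|nab] := eqVneq a.1 b.1; have [ebc|nbc] := eqVneq b.1 c.1.
  - move=> ab bc; rewrite (letter_eq eab ab) (letter_eq ebc bc).
    by have := fgpV_lt (s1 c); rewrite fgpC; lia.
  - move=> ab _; rewrite (letter_eq eab ab).
    by have := fgpV_lt (s1 b); have := half' _ _ nbc; rewrite (fgpC (s b)); lia.
  - move=> _ bc; rewrite -(letter_eq ebc bc).
    by have := fgpV_lt (s1 b); have := half _ _ nab; rewrite (fgpC (s b)); lia.
  (* Half of [s b] cancels on each side: then a = c, and conjugating shortens. *)
  move=> _ _; have Hab := half _ _ nab; have Hbc := half' _ _ nbc.
  rewrite ltnNge; apply/negP => Hb.
  have eab : (fgp (s a)^-1 (s b)).*2 = flen (s b) by lia.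
  have ebc : (fgp (s b)^-1 (s c)).*2 = flen (s b) by lia.
  (* If c is the inverse of a, then [s b] and its inverse both agree with [(s a)^-1] on half their
     length, hence with each other, against [fgpV_lt]. *)
  have [ac|ac] := eqVneq c (letter_inv a).
    move: ebc; rewrite ac sV => ebc.
    have := fgp_trans (s b) (s a)^-1 (s b)^-1; have := fgpV_lt (s1 b).
    by rewrite (fgpC _ (s a)^-1) (fgpC (s a)^-1 (s b)^-1); lia.
  have eac : a.1 = c.1 by apply: letter_neq2 nab nbc.
  rewrite -(letter_eq eac ac) in ebc nbc.
  have [q [q1 q2]] : exists q, (flen ((s a * s b) ^ q) + (fgp (s a)^-1 (s b)).*2 <= flen (s a))%N /\
      (flen (s b ^ q) <= flen (s b))%N.
    apply: half_cancel_shorten => //; last by have := half' _ _ nab.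
    by lia.
  apply/nP/(Pl _ _ nab)/Pmul'/(Pconj' _ _ q)/IH; last exact/basis_conj/basis_mul/Bl.
  have := Ll _ _ nab; rewrite -/s.
  by have := flen_gt0 (s1 b); lia.
have [alpha [[beta _ K] ax ay]] := uv.
have E z : free_lift (pair_fun u v) z = alpha z.
  by apply: free2_eq; rewrite /= ?free_lift_x ?free_lift_y.
(* The preimage of an element of length one has length at most one, and it is not empty. *)
have gen (t : 'Free_2) : flen t = 1%N -> exists a, t = s a.
  move=> t1; have := free_lift_flen small (beta t); rewrite E K t1.
  case Eb: (beta t) => [[|a [|//]] rw] _ /=.
    by move: t1; rewrite -[t]K Eb -E /free_lift /word_lift /= big_nil.
  by exists a; rewrite -[t]K Eb -E /free_lift /word_lift /= big_seq1.
have [a xa] := gen free_x (erefl _); have [b yb] := gen free_y (erefl _).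
apply/nP/(Pl a b); last by rewrite -xa -yb.
apply/eqP => eab; have [ab|ab] := eqVneq b (letter_inv a).
  by have := congr1 (@free_word _) yb; rewrite ab sV -xa.
by have := congr1 (@free_word _) yb; rewrite -(letter_eq eab ab) -xa.
Qed.
End NielsenRank2.

(** * Characteristic quotients from braid triples *)

Lemma multiplicative_exists (G H : groupType) (f : G -> H) :
  {morph f : x y / (x * y)%g} -> exists s : {multiplicative G -> H}, s =1 f.
Proof.
move=> fM; pose fMult := isMultiplicative.Build G H f fM.
by exists (HB.pack_for {multiplicative G -> H} f fMult).
Qed.

Section BraidPair.
Local Open Scope group_scope.
Variables (gT : groupType) (s1 s2 s3 : gT).
Hypotheses (s121 : s1 * s2 * s1 = s2 * s1 * s2) (s323 : s3 * s2 * s3 = s2 * s3 * s2)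
  (s13 : s1 * s3 = s3 * s1).

Definition braid_a := s1 * s3^-1.
Definition braid_b := s2 * braid_a * s2^-1.
Local Notation a := braid_a.
Local Notation b := braid_b.

Let s1V3 : s1 * s3^-1 = s3^-1 * s1.
Proof. by apply: (mulgI s3); apply: (mulIg s3); rewrite !mulgA mulgV mul1g mulgVK s13. Qed.

Let s12 : s1^-1 * s2 * s1 = s2 * s1 * s2^-1.
Proof. by apply: (mulgI s1); apply: (mulIg s2); rewrite !mulgA mulgV mul1g mulgVK s121. Qed.

Let s32 : s3 * s2 * s3^-1 = s2^-1 * s3 * s2.
Proof. by apply: (mulgI s2); apply: (mulIg s3); rewrite !mulgA mulgV mul1g mulgVK s323. Qed.

Let s23V : s2 * s3^-1 * s2^-1 = s3^-1 * s2^-1 * s3.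
Proof.
apply: (mulgI s3); apply: (mulIg s2); rewrite !mulgA mulgV mul1g mulgVK.
apply: (mulIg s3); rewrite mulgVK; apply: (mulgI s2).
by rewrite -(mulgA s2^-1) -(mulgA s2^-1) s323 !mulgA mulgV mul1g.
Qed.

Let s232V : s2^-1 * s3^-1 * s2^-1 = s3^-1 * s2^-1 * s3^-1.
Proof. by rewrite -[LHS]invgK -[RHS]invgK; congr (_^-1); rewrite !invgM !invgK !mulgA s323. Qed.

Let s1b : s1 * b = b * s3.
Proof.
transitivity (s1 * s2 * s1 * s3^-1 * s2^-1); first by rewrite /b /a !mulgA.
rewrite s121; transitivity (s2 * s1 * (s2 * s3^-1 * s2^-1)).
  by rewrite !mulgA.
by rewrite s23V /b /a !mulgA.
Qed.

(** Reads a^-1 b a^-1 = (a^-1)^s2, the identity behind both [braid_b_conj2] and [braid_b_theta]. *)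
Let ba : a^-1 * s2 * a * s2^-1 = s2^-1 * a^-1 * s2 * a.
Proof.
rewrite /a invgM invgK !mulgA.
have E : s1^-1 * s2 * s1 = s2 * s1 * s2^-1 := s12.
transitivity (s3 * (s1^-1 * s2 * s1) * s3^-1 * s2^-1); first by rewrite !mulgA.
transitivity (s2^-1 * s3 * (s1^-1 * s2 * s1) * s3^-1); last by rewrite !mulgA.
rewrite E; transitivity (s3 * s2 * s1 * (s2^-1 * s3^-1 * s2^-1)).
  by rewrite !mulgA.
rewrite s232V; transitivity (s3 * s2 * (s1 * s3^-1) * s2^-1 * s3^-1).
  by rewrite !mulgA.
rewrite s1V3; transitivity (s3 * s2 * s3^-1 * s1 * s2^-1 * s3^-1).
  by rewrite !mulgA.
by rewrite s32 !mulgA.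
Qed.

Lemma braid_a_conj1 : a ^ s1^-1 = a.
Proof. by rewrite conjgE invgK /a -!mulgA (mulgA s1 s3^-1) s1V3 mulgK. Qed.

Lemma braid_b_conj1 : b ^ s1^-1 = b * a^-1.
Proof.
have -> : b ^ s1^-1 = s1 * b * s1^-1 by rewrite conjgE invgK mulgA.
by rewrite s1b /a invgM invgK mulgA.
Qed.

Lemma braid_a_conj3 : a ^ s3^-1 = a.
Proof. by rewrite conjgE invgK {1}/a s1V3 !mulgA mulgV mul1g. Qed.

Lemma braid_b_conj3 : b ^ s3^-1 = a^-1 * b.
Proof.
have -> : b ^ s3^-1 = s3 * (s1^-1 * (s1 * b)) * s3^-1.
  by rewrite conjgE invgK mulKg mulgA.
rewrite s1b; have -> : a^-1 = s3 * s1^-1 by rewrite invgM invgK.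
by rewrite !mulgA mulgK.
Qed.

Lemma braid_a_conj2 : a ^ s2^-1 = b.
Proof. by rewrite conjgE invgK mulgA. Qed.

Lemma braid_b_conj2 : b ^ s2^-1 = b * a^-1 * b.
Proof.
have E : b = a * (s2^-1 * a^-1 * s2 * a) by rewrite -ba /b !mulgA mulgV mul1g.
by rewrite conjgE invgK {1}E /b !mulgA.
Qed.

Variable theta : {multiplicative gT -> gT}.
Hypotheses (theta_inj : injective theta) (theta1 : theta s1 = s1^-1)
  (theta2 : theta s2 = s2^-1) (theta3 : theta s3 = s3^-1).

Lemma braid_a_theta : theta a = a^-1.
Proof.
rewrite /a gmulfM multV theta1 theta3 invgM !invgK.
by apply: (mulgI s1); apply: (mulIg s1); rewrite !mulgA mulgV mul1g mulgVK s13.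
Qed.

Lemma braid_b_theta : theta b = a^-1 * b * a^-1.
Proof.
have E : s2^-1 * a^-1 * s2 * a = a^-1 * b by rewrite -ba /b !mulgA.
rewrite {1}/b 2!gmulfM multV theta2 braid_a_theta invgK.
by apply: (mulIg a); rewrite E mulgVK.
Qed.

Definition braid_lift : {multiplicative 'Free_2 -> gT} := free_lift (pair_fun a b).

(** Nielsen's theorem for the set of pairs whose images are the values at (a, b) of an injective
    endomorphism of [gT]. Conjugations by the s_i, by [braid_lift g], and [theta] supply the
    moves. *)
Lemma braid_lift_aut u v : basis u v ->
  exists s : {multiplicative gT -> gT},
    [/\ injective s, s a = braid_lift u & s b = braid_lift v].
Proof.
pose P u v := exists s : {multiplicative gT -> gT},
    [/\ injective s, s a = braid_lift u & s b = braid_lift v].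
(* The map c is applied first: if it moves (a, b) as the words x, y prescribe, then s after c
   realises these words with (u1, v1) substituted. Hence a move known at (a, b) applies to every
   pair in P. *)
have Pcomp (c : {multiplicative gT -> gT}) x y u1 v1 : injective c ->
    c a = braid_lift x -> c b = braid_lift y ->
    P u1 v1 -> P (free_lift (pair_fun u1 v1) x) (free_lift (pair_fun u1 v1) y).
  move=> ic ca cb [s [is_ sa sb]]; exists (s \o c).
  have E z : s (braid_lift z) = braid_lift (free_lift (pair_fun u1 v1) z).
    pose g1 : {multiplicative 'Free_2 -> gT} := s \o braid_lift.
    pose g2 : {multiplicative 'Free_2 -> gT} :=
      braid_lift \o free_lift (pair_fun u1 v1).
    suff : g1 z = g2 z by [].
    by apply: free2_eq; rewrite /= ?free_lift_x ?free_lift_y.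
  by split; [exact: inj_comp|rewrite /= ca|rewrite /= cb].
have inner_inj g : injective (inner (g : gT)) by apply: bij_inj (inner_bij g).
have lx : braid_lift free_x = a by apply: free_lift_x.
have ly : braid_lift free_y = b by apply: free_lift_y.
have bM w z : braid_lift (w * z) = braid_lift w * braid_lift z by apply: gmulfM.
have bV w : braid_lift w^-1 = (braid_lift w)^-1 by apply: multV.
have fM (f : 'I_2 -> 'Free_2) w z : free_lift f (w * z) = free_lift f w * free_lift f z.
  exact: gmulfM.
have fV (f : 'I_2 -> 'Free_2) w : free_lift f w^-1 = (free_lift f w)^-1.
  exact: multV.
pose x := free_x; pose y := free_y.
have P1 u1 v1 : P u1 v1 -> P u1 (v1 * u1^-1).
  move=> /(Pcomp (inner s1^-1) x (y * x^-1)).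
  rewrite !bM !bV lx ly !fM !fV !free_lift_x ?free_lift_y; apply=> //.
  - exact: inner_inj.
  - exact: braid_a_conj1.
  exact: braid_b_conj1.
have P3 u1 v1 : P u1 v1 -> P u1 (u1^-1 * v1).
  move=> /(Pcomp (inner s3^-1) x (x^-1 * y)).
  rewrite !bM !bV lx ly !fM !fV !free_lift_x ?free_lift_y; apply=> //.
  - exact: inner_inj.
  - exact: braid_a_conj3.
  exact: braid_b_conj3.
have P2 u1 v1 : P u1 v1 -> P v1 (v1 * u1^-1 * v1).
  move=> /(Pcomp (inner s2^-1) y (y * x^-1 * y)).
  rewrite !bM !bV lx ly !fM !fV !free_lift_x ?free_lift_y; apply=> //.
  - exact: inner_inj.
  - exact: braid_a_conj2.
  exact: braid_b_conj2.
have Pinv u1 v1 : P u1 v1 -> P u1^-1 v1.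
  (* [theta] gives (u^-1, u^-1 v u^-1); the moves [P1] and [P3] then remove the two outer factors
     u^-1. *)
  move=> H; have {H} : P u1^-1 (u1^-1 * v1 * u1^-1).
    move: H => /(Pcomp theta x^-1 (x^-1 * y * x^-1)).
    rewrite !bM !bV lx ly !fM !fV !free_lift_x ?free_lift_y; apply=> //.
      exact: braid_a_theta.
    exact: braid_b_theta.
  by move=> /P1/P3; rewrite invgK mulgVK mulKVg.
have Pswap u1 v1 : P u1 v1 -> P v1 u1.
  by move=> /Pinv/P2/P1/P3; rewrite invgK mulgK mulKg.
apply: (nielsen_rank2 (P := P)) => [|||u1 v1|u1 v1 g].
- by exists idfun; rewrite lx ly.
- exact: Pswap.
- exact: Pinv.
- by move=> /Pswap/Pinv/P1; rewrite invgK => /Pinv; rewrite invgK => /Pswap.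
case=> s [is_ sa sb]; exists (inner (braid_lift g) \o s).
split; first by apply: inj_comp; first exact: inner_inj.
  by rewrite /= sa /inner conjgE -bV -!bM.
by rewrite /= sb /inner conjgE -bV -!bM.
Qed.

(** For an automorphism alpha of F_2 there is an injective s with s(lift z) = lift(alpha z), so
    alpha and its inverse preserve the kernel. *)
Lemma braid_kernel_characteristic :
  characteristic_subgroup [set z | braid_lift z = 1]%classic.
Proof.
split.
  split; first by rewrite inE /= mult1.
  move=> y z; rewrite !inE /= => y1 z1.
  have -> : braid_lift (y * z^-1) = braid_lift y * (braid_lift z)^-1.
    by rewrite -multV -gmulfM.
  by rewrite (y1 : braid_lift y = 1) (z1 : braid_lift z = 1) mulgV.
have stable (alpha : {multiplicative 'Free_2 -> 'Free_2}) z : bijective alpha ->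
    braid_lift (alpha z) = 1 <-> braid_lift z = 1.
  move=> bij; have [|s [is_ sa sb]] := @braid_lift_aut (alpha free_x) (alpha free_y).
    by exists alpha.
  have E : s (braid_lift z) = braid_lift (alpha z).
    pose g1 : {multiplicative 'Free_2 -> gT} := s \o braid_lift.
    pose g2 : {multiplicative 'Free_2 -> gT} := braid_lift \o alpha.
    suff : g1 z = g2 z by [].
    by apply: free2_eq; rewrite /= ?free_lift_x ?free_lift_y.
  rewrite -E; split=> [H|->]; last by rewrite mult1.
  by apply: is_; rewrite H mult1.
move=> alpha bij; apply/seteqP; split=> [_ [z /= z1 <-]|z /= z1].
  exact/stable.
have [beta _ K] := bij; exists (beta z); last exact: K.
by apply/(stable alpha) => //; rewrite K.
Qed.

End BraidPair.

(** * Transvections in dimension three *)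

Lemma GL_groupM (R : finComUnitRingType) n (H : {group {'GL_n[R]}}) a b :
  a \in H -> b \in H -> (a * b)%g \in H.
Proof. exact: groupM. Qed.

Lemma GL_groupV (R : finComUnitRingType) n (H : {group {'GL_n[R]}}) a :
  a \in H -> (a^-1)%g \in H.
Proof. exact: groupVr. Qed.

Section Transvections.
Import GRing.Theory.
Local Open Scope ring_scope.
Variable F : finFieldType.
(** [F_natr] makes F a prime field: the powers of one transvection are then all its scalar
    multiples. *)
Hypotheses (F_natr : forall c : F, exists n, c = n%:R) (F_card : #|F|%:R = 0 :> F).
Local Notation GL := {'GL_3[F]}.
Implicit Types (f g : 'cV[F]_3) (u v w : 'rV[F]_3) (H : {group GL}).

Lemma mul_row_col_row u f v : u *m f *m v = (u *m f) 0 0 *: v.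
Proof. by rewrite {1}[u *m f]mx11_scalar mul_scalar_mx. Qed.

Lemma mul_col_row_col f u g : f *m (u *m g) = (u *m g) 0 0 *: f.
Proof. by rewrite {1}[u *m g]mx11_scalar mul_mx_scalar. Qed.

Lemma row_col_eq0 u f : (u *m f == 0) = ((u *m f) 0 0 == 0).
Proof.
apply/eqP/eqP => [->|E]; first by rewrite mxE.
by rewrite [u *m f]mx11_scalar E raddf0.
Qed.

Lemma GL_exists (M N : 'M[F]_3) : M *m N = 1%:M -> exists g : GL, GLval g = M.
Proof.
move=> MN; have [uM _] := mulmx1_unit MN.
by exists (FinRing.unit 'M[F]_3 uM).
Qed.

Lemma GL_inv_val (g : GL) (N : 'M[F]_3) : GLval g *m N = 1%:M -> GLval g^-1%g = N.
Proof.
move=> gN; rewrite GL_VxE -[RHS](mulKmx (GL_unit g)) gN mulmx1.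
by [].
Qed.

Lemma GL_inj (a b : GL) : GLval a = GLval b -> a = b.
Proof. exact: val_inj. Qed.

(* Matrices act on row vectors on the right. The map 1 + f u is a transvection
   only when u *m f = 0. *)
Definition has_tv H f u := exists2 g, g \in H & GLval g = 1%:M + f *m u.

Lemma tv_mulN f u : u *m f = 0 -> (1%:M + f *m u) *m (1%:M - f *m u) = 1%:M.
Proof.
move=> uf; rewrite mulmxDl mul1mx mulmxBr mulmx1 mulmxA -(mulmxA f u f) uf.
by rewrite mulmx0 mul0mx subr0 subrK.
Qed.

Lemma tv_expg (a : GL) f u n : u *m f = 0 -> GLval a = 1%:M + f *m u ->
  GLval (a ^+ n)%g = 1%:M + f *m (n%:R *: u).
Proof.
move=> uf Ea; elim: n => [|n IH]; first by rewrite scale0r mulmx0 addr0.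
rewrite expgS GL_MxE IH Ea mulmxDl mul1mx mulmxDr mulmx1 mulmxA.
rewrite -(mulmxA f u f) uf mulmx0 mul0mx addr0 mulrS scalerDl scale1r mulmxDr.
by rewrite -addrA (addrC (f *m u)).
Qed.

Lemma has_tv0 H f : has_tv H f 0.
Proof. by exists 1%g; rewrite ?group1 // mulmx0 addr0. Qed.

Lemma has_tvDr H f u w : u *m f = 0 ->
  has_tv H f u -> has_tv H f w -> has_tv H f (u + w).
Proof.
move=> uf [a Ha Ea] [b Hb Eb]; exists (a * b)%g; first exact: GL_groupM.
rewrite GL_MxE Ea Eb mulmxDl mul1mx mulmxDr mulmx1 mulmxA -(mulmxA f u f) uf.
by rewrite mulmx0 mul0mx addr0 mulmxDr -addrA (addrC (f *m w)).
Qed.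

Lemma has_tvDl H f g u : u *m g = 0 ->
  has_tv H f u -> has_tv H g u -> has_tv H (f + g) u.
Proof.
move=> ug [a Ha Ea] [b Hb Eb]; exists (a * b)%g; first exact: GL_groupM.
rewrite GL_MxE Ea Eb mulmxDl mul1mx mulmxDr mulmx1 mulmxA -(mulmxA f u g) ug.
by rewrite mulmx0 mul0mx addr0 mulmxDl -addrA (addrC (g *m u)).
Qed.

Lemma has_tvZr H f u c : u *m f = 0 -> has_tv H f u -> has_tv H f (c *: u).
Proof.
move=> uf Hu; have [n ->] := F_natr c; elim: n => [|n IH].
  by rewrite scale0r; apply: has_tv0.
by rewrite mulrS scalerDl scale1r; apply: has_tvDr.
Qed.

Lemma has_tvZ H f u c : has_tv H (c *: f) u <-> has_tv H f (c *: u).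
Proof. by rewrite /has_tv -scalemxAl -scalemxAr. Qed.

Lemma has_tvZl H f u c : u *m f = 0 -> has_tv H f u -> has_tv H (c *: f) u.
Proof. by move=> uf Hu; apply/has_tvZ; apply: has_tvZr. Qed.

Lemma tv_conjE (a h : GL) f u : GLval a = 1%:M + f *m u ->
  GLval (a ^ h)%g = 1%:M + (GLval h^-1%g *m f) *m (u *m GLval h).
Proof.
move=> Ea; rewrite conjgE !GL_MxE Ea mulmxDl mulmxDr mul1mx -(@GL_MxE 3) mulVg.
by congr (_ + _); rewrite !mulmxA.
Qed.

Lemma has_tv_conj H (h : GL) f u : h \in 'N(H)%g ->
  has_tv H f u -> has_tv H (GLval h^-1%g *m f) (u *m GLval h).
Proof.
move=> nHh [a Ha Ea]; exists (a ^ h)%g; first by rewrite memJ_norm.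
exact: tv_conjE.
Qed.

Section FullVectors.
(** Directions are restricted to a linear subspace W, because the generation argument below first
    works in two planes and only then in the whole space. *)
Variables (H : {group GL}) (W : 'cV[F]_3 -> Prop).
Hypothesis W_lin : forall f g c, W f -> W g -> W (f + c *: g).
Hypothesis W_scale : forall f c, W f -> W (c *: f).

Definition full_vector u := forall f, W f -> u *m f = 0 -> has_tv H f u.

Lemma full_vectorZ u c : full_vector u -> full_vector (c *: u).
Proof.
move=> Pu f Wf; have [->|c0] := eqVneq c 0; first by rewrite scale0r => _; apply: has_tv0.
rewrite -scalemxAl => /eqP; rewrite scaler_eq0 (negPf c0) /= => /eqP uf.
exact/has_tvZr/Pu.
Qed.

Lemma full_vector_conj u (h : GL) : h \in 'N(H)%g ->
  (forall f, W f -> W (GLval h *m f)) -> full_vector u -> full_vector (u *m GLval h).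
Proof.
move=> nHh Wh Pu f Wf uhf; have := has_tv_conj nHh (Pu _ (Wh _ Wf) _).
by rewrite !mulmxA -GL_MxE mulVg mul1mx; apply.
Qed.

(* Conjugating by a transvection along u moves v to v + c *: u. *)
Lemma full_vector_add u v f c : W f -> u *m f = 0 -> v *m f != 0 ->
  full_vector u -> full_vector v -> full_vector (v + c *: u).
Proof.
move=> Wf uf; rewrite row_col_eq0 => vf Pu Pv.
pose f' := (c / (v *m f) 0 0) *: f.
have Wf' : W f' by apply: W_scale.
have uf' : u *m f' = 0 by rewrite -scalemxAr uf scaler0.
have vf' : (v *m f') 0 0 = c by rewrite -scalemxAr mxE divfK.
have [h Hh Eh] := Pu _ Wf' uf'.
have Evh : v *m GLval h = v + c *: u.
  by rewrite Eh mulmxDr mulmx1 mulmxA mul_row_col_row vf'.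
rewrite -Evh; apply: full_vector_conj => //; first exact: fintype.subsetP (normG H) _ Hh.
by move=> g Wg; rewrite Eh mulmxDl mul1mx -mulmxA mul_col_row_col; apply: W_lin.
Qed.

End FullVectors.

Lemma row_sep u v : ~~ (v <= u)%MS -> exists f, u *m f = 0 /\ v *m f != 0.
Proof.
move=> vu; have : v *m cokermx u != 0 by rewrite -submxE.
case/rV0Pn=> j vj; exists (cokermx u *m delta_mx j 0).
split; first by rewrite mulmxA mulmx_coker mul0mx.
by rewrite mulmxA row_col_eq0 -colE mxE.
Qed.

Lemma full_vectorD H u v c : full_vector H (fun=> True) u ->
  full_vector H (fun=> True) v -> full_vector H (fun=> True) (v + c *: u).
Proof.
move=> Pu Pv; have [/sub_rVP[a ->]|/row_sep[f [uf vf]]] := boolP (v <= u)%MS.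
  by rewrite -scalerDl; apply: full_vectorZ.
exact: (full_vector_add _ _ _ uf vf).
Qed.

(** * Simplicity of the group generated by transvections *)

Definition tv_group : {group GL} :=
  <<[set g : GL | [exists f : 'cV[F]_3, exists u : 'rV[F]_3,
       (u *m f == 0) && (GLval g == 1%:M + f *m u)]]>>%G.

Lemma has_tv_group f u : u *m f = 0 -> has_tv tv_group f u.
Proof.
move=> uf; have [g Eg] := GL_exists (tv_mulN uf); exists g => //.
apply: mem_gen; rewrite inE; apply/existsP; exists f; apply/existsP; exists u.
by rewrite uf Eg !eqxx.
Qed.

Lemma tv_group_sub H :
  (forall f u, u *m f = 0 -> has_tv H f u) -> tv_group \subset H.
Proof.
move=> Htv; rewrite gen_subG; apply/fintype.subsetP => g; rewrite inE.
case/existsP=> f /existsP[u /andP[/eqP uf /eqP Eg]].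
by have [a Ha Ea] := Htv f u uf; have -> : g = a by apply: val_inj; rewrite [LHS]Eg [RHS]Ea.
Qed.

Lemma tv_group_norm (h : GL) : h \in 'N(tv_group)%g.
Proof.
rewrite inE -genJ gen_subG; apply/fintype.subsetP => a /imsetP[g gT Ea].
have {}Ea : a = ((g : GL) ^ h)%g by [].
move: gT; rewrite inE => /existsP[f /existsP[u /andP[/eqP uf /eqP Eg]]].
apply: mem_gen; rewrite inE; apply/existsP; exists (GLval h^-1%g *m f).
apply/existsP; exists (u *m GLval h).
have -> : u *m GLval h *m (GLval h^-1%g *m f) = 0.
  by rewrite mulmxA -(mulmxA u) -(@GL_MxE 3) mulgV mulmx1 uf.
by rewrite eqxx Ea (tv_conjE _ Eg) /=.
Qed.

(** A transvection has trivial |F|-th power, while every scalar equals its own |F|-th power; so its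
    determinant is 1 without any expansion. *)
Lemma tv_group_det (g : GL) : g \in tv_group -> \det (GLval g) = 1.
Proof.
have grD : group_set [set g : GL | \det (GLval g) == 1].
  apply/group_setP; split=> [|a b]; rewrite !inE ?det1 // GL_MxE det_mulmx.
  by move=> /eqP-> /eqP->; rewrite mulr1.
suff /fintype.subsetP/(_ g) : tv_group \subset Group grD by rewrite inE => H /H/eqP.
apply: tv_group_sub => f u uf; have [a Ea] := GL_exists (tv_mulN uf).
exists a => //; rewrite inE.
have aX n := tv_expg n uf Ea.
have detX n : \det (GLval (a ^+ n)%g) = \det (GLval a) ^+ n.
  by elim: n => [|n IH]; rewrite ?det1 // expgS GL_MxE det_mulmx IH exprS.
by have := detX #|F|; rewrite (aX #|F|) F_card scale0r mulmx0 addr0 det1 expf_card => <-.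
Qed.

(** Conjugation by 1 + g w. It corrects direction and functional at once; the uses below make one of
    the corrections vanish. *)
Lemma has_tv_norm (N : {group GL}) f u g w :
  tv_group \subset 'N(N)%g -> w *m g = 0 -> has_tv N f u ->
  has_tv N (f - (w *m f) 0 0 *: g) (u + (u *m g) 0 0 *: w).
Proof.
move=> nN wg Hu; have [a Ta Ea] := has_tv_group wg.
have EaV : GLval a^-1%g = 1%:M - g *m w.
  by apply: GL_inv_val; rewrite Ea tv_mulN.
have := has_tv_conj (fintype.subsetP nN _ Ta) Hu.
by rewrite EaV Ea mulmxBl mulmxDr mul1mx mulmx1 !mulmxA mul_row_col_row
  -(mulmxA g) mul_col_row_col.
Qed.

(* From one transvection of N one gets those with the same functional, then
   those with the same direction, hence all of them since any two functionals
   on F^3 have a common nonzero zero. *)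
Lemma has_tv_normal_all (N : {group GL}) f u :
  tv_group \subset 'N(N)%g -> u *m f = 0 -> f != 0 -> u != 0 -> has_tv N f u ->
  forall g w, w *m g = 0 -> has_tv N g w.
Proof.
move=> nN uf f0 u0 Nfu.
have scale_r f1 u1 c : u1 *m f1 = 0 -> c != 0 -> has_tv N f1 (c *: u1) -> has_tv N f1 u1.
  move=> uf1 c0 H; rewrite -[u1](scalerK c0); apply: has_tvZr => //.
  by rewrite -scalemxAl uf1 scaler0.
have all_u f1 u1 : u1 *m f1 = 0 -> u1 != 0 -> has_tv N f1 u1 ->
    forall w, w *m f1 = 0 -> has_tv N f1 w.
  move=> uf1 u10 Nfu1 w wf.
  have [/sub_rVP[c Eu]|/row_sep[g [wg ug]]] := boolP (u1 <= w)%MS.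
    have c0 : c != 0 by apply: contraNneq u10 => c0; rewrite Eu c0 scale0r.
    by apply: scale_r c0 _; rewrite // -Eu.
  have := has_tv_norm nN wg Nfu1; rewrite wf mxE scale0r subr0 => Nfuw.
  rewrite row_col_eq0 in ug; apply: scale_r ug _ => //.
  rewrite -[_ *: w](addKr u1) -scaleN1r; apply: has_tvDr => //.
    by rewrite -scalemxAl uf1 scaler0.
  exact: has_tvZr.
have all_f f1 u1 : u1 *m f1 = 0 -> f1 != 0 -> has_tv N f1 u1 ->
    forall g, u1 *m g = 0 -> has_tv N g u1.
  move=> uf1 f10 Nfu1 g ug.
  have [/sub_rVP[c Ef]|] := boolP (f1^T <= g^T)%MS.
    have {}Ef : f1 = c *: g by apply: trmx_inj; rewrite Ef linearZ.
    have c0 : c != 0 by apply: contraNneq f10 => c0; rewrite Ef c0 scale0r.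
    by apply: (scale_r _ _ _ ug c0); apply/has_tvZ; rewrite -Ef.
  case/row_sep=> h [gh fh]; pose w := h^T.
  have wg : w *m g = 0 by apply: trmx_inj; rewrite trmx_mul trmxK gh trmx0.
  have wf : (w *m f1) 0 0 != 0.
    rewrite -row_col_eq0; apply: contraNneq fh => wf.
    by apply/eqP/trmx_inj; rewrite trmx_mul trmxK wf trmx0.
  have := has_tv_norm nN wg Nfu1; rewrite ug [X in u1 + X *: _]mxE scale0r addr0 => Nfuw.
  apply: scale_r wf _ => //; apply/has_tvZ.
  have -> : (w *m f1) 0 0 *: g = f1 - (f1 - (w *m f1) 0 0 *: g) by rewrite opprB addrC subrK.
  apply: has_tvDl => //; first by rewrite mulmxN mulmxBr uf1 -scalemxAr ug scaler0 subr0 oppr0.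
  by rewrite -scaleN1r; apply: has_tvZl => //; rewrite mulmxBr uf1 -scalemxAr ug scaler0 subr0.
move=> g v vg.
have [->|g0] := eqVneq g 0; first by exists 1%g; rewrite ?group1 // mul0mx addr0.
have [w [w0 wf wg]] : exists w : 'rV[F]_3, [/\ w != 0, w *m f = 0 & w *m g = 0].
  have : kermx (row_mx f g) != 0.
    rewrite -mxrank_eq0 mxrank_ker subn_eq0 -ltnNge.
    exact: leq_ltn_trans (rank_leq_col _) _.
  case/rowV0Pn=> w /sub_kermxP; rewrite mul_mx_row => E w0.
  by exists w; split=> //; [have := congr1 lsubmx E|have := congr1 rsubmx E];
    rewrite ?row_mxKl ?row_mxKr ?linear0.
apply: (all_u _ w) => //; apply: (all_f f) => //.
exact: (all_u _ u).
Qed.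

Lemma row_stable_scalar (M : 'M[F]_3) :
  (forall u : 'rV[F]_3, u *m M <= u)%MS -> M = (M 0 0)%:M.
Proof.
move=> Mu.
have off i j : j != i -> M i j = 0.
  move=> ji; have /sub_rVP[c] := Mu (delta_mx 0 i); rewrite -rowE.
  by move/rowP/(_ j); rewrite !mxE (negPf ji) andbF mulr0.
have diag i : M i i = M 0 0.
  have [-> //|i0] := eqVneq i 0.
  have /sub_rVP[c] := Mu (delta_mx 0 0 + delta_mx 0 i).
  rewrite mulmxDl -!rowE => /rowP E; have := E 0; have := E i.
  rewrite !mxE !eqxx /= (eq_sym 0 i) (negPf i0) (off 0 i) // (off i 0) 1?eq_sym // add0r !mulr0n.
  by rewrite !addr0 add0r mulr1 => -> ->.
apply/matrixP=> i j; rewrite [RHS]mxE.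
by case: eqVneq => [->|ij]; rewrite ?diag ?mulr1n // off 1?eq_sym.
Qed.

Lemma kernel_pair_prop u v f g : ~~ (v <= u)%MS -> u != 0 -> f != 0 ->
  u *m f = 0 -> v *m f = 0 -> u *m g = 0 -> v *m g = 0 -> exists c, g = c *: f.
Proof.
move=> vu u0 f0 uf vf ug vg.
have rk : \rank (kermx (row_mx u^T v^T)) = 1%N.
  have : (\rank u < \rank (u + v)%MS)%N.
    by apply: rank_ltmx; rewrite ltmxE addsmxSl addsmx_sub submx_refl.
  have := rank_leq_row (col_mx u v).
  rewrite addsmxE mxrank_ker -tr_col_mx mxrank_tr rank_rV u0 /=.
  by case: (\rank _) => [|[|[|]]].
have ker (h : 'cV[F]_3) : u *m h = 0 -> v *m h = 0 -> (h^T <= kermx (row_mx u^T v^T))%MS.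
  move=> uh vh; apply/sub_kermxP.
  by rewrite mul_mx_row -!trmx_mul uh vh !trmx0 row_mx0.
have fE : (kermx (row_mx u^T v^T) <= f^T)%MS.
  have [_ <-] := mxrank_leqif_sup (ker _ uf vf).
  by rewrite rk rank_rV trmx_eq0 f0.
have /sub_rVP[c E] := submx_trans (ker _ ug vg) fE.
by exists c; apply: trmx_inj; rewrite E linearZ.
Qed.

(** Let u' = u a, let f be killed by u and u', and t = 1 + f u. The commutator b = t^-1 t^a lies in
    N, where t^a = 1 + f' u' with f' = a^-1 f. If u f' = 0, then f' is a multiple of f and b is a
    transvection. Otherwise b fixes f and moves u by a nonzero multiple of u', so the commutator
    t^-1 t^b is one. *)
Lemma normal_has_tv (N : {group GL}) (a : GL) u :
  tv_group \subset 'N(N)%g -> a \in N -> ~~ (u *m GLval a <= u)%MS ->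
  exists f v, [/\ v *m f = 0, f != 0, v != 0 & has_tv N f v].
Proof.
move=> nN Na; set u' := u *m _ => u'u.
have u0 : u != 0 by apply: contraNneq u'u => E; rewrite /u' E mul0mx sub0mx.
have u'0 : u' != 0 by apply: contraNneq u'u => ->; rewrite sub0mx.
have [f [f0 uf u'f]] : exists f : 'cV[F]_3, [/\ f != 0, u *m f = 0 & u' *m f = 0].
  have : cokermx (col_mx u u') != 0.
    rewrite -mxrank_eq0 mxrank_coker subn_eq0 -ltnNge.
    exact: leq_ltn_trans (rank_leq_row _) _.
  rewrite -trmx_eq0 => /rowV0Pn[w ws w0]; exists w^T.
  have /(congr1 trmx) : w *m (col_mx u u')^T = 0.
    have /submxP[D ->] := ws.
    by rewrite -mulmxA -trmx_mul mulmx_coker trmx0 mulmx0.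
  rewrite trmx_mul trmxK trmx0 mul_col_mx => E; rewrite trmx_eq0; split=> //.
    by have := congr1 usubmx E; rewrite col_mxKu linear0.
  by have := congr1 dsubmx E; rewrite col_mxKd linear0.
have [t Tt Et] := has_tv_group uf.
pose f' := GLval a^-1%g *m f.
have Etv : GLval t^-1%g = 1%:M - f *m u by apply: GL_inv_val; rewrite Et tv_mulN.
have Eta : GLval (t ^ a)%g = 1%:M + f' *m u'.
  exact: tv_conjE.
have nt : t \in 'N(N)%g by apply: (fintype.subsetP nN).
pose b := (t^-1 * t ^ a)%g.
have Nb : b \in N.
  have -> : b = ((a^-1) ^ t * a)%g by rewrite /b !conjgE !mulgA.
  by apply: GL_groupM => //; rewrite memJ_norm //; apply: GL_groupV.
have u'f' : u' *m f' = 0.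
  by rewrite /u' /f' mulmxA -(mulmxA u) -(@GL_MxE 3) mulgV mulmx1.
have Eb : GLval b = (1%:M - f *m u) *m (1%:M + f' *m u') by rewrite GL_MxE Etv Eta.
have [uf'|uf'] := eqVneq (u *m f') 0.
  have [c Ef'] := kernel_pair_prop u'u u0 f0 uf u'f uf' u'f'.
  exists f, (c *: u' - u); split=> //.
  - by rewrite mulmxBl -scalemxAl u'f uf scaler0 subrr.
  - rewrite subr_eq0; apply: contraNneq u'u => E.
    have c0 : c != 0 by apply: contraNneq u0 => c0; rewrite -E c0 scale0r.
    by rewrite -E; apply/sub_rVP; exists c^-1; rewrite scalerK.
  exists b => //; rewrite Eb mulmxBl mul1mx mulmxDr mulmx1.
  rewrite -(mulmxA f) (mulmxA u) uf' mul0mx mulmx0 addr0 Ef'.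
  by rewrite mulmxBr -scalemxAl -scalemxAr addrA.
exists f, ((u *m f') 0 0 *: u'); rewrite row_col_eq0 in uf'; split=> //.
- by rewrite -scalemxAl u'f scaler0.
- by rewrite scaler_eq0 negb_or uf'.
exists (t^-1 * t ^ b)%g.
  have -> : (t^-1 * t ^ b = (b^-1) ^ t * b)%g by rewrite !conjgE !mulgA.
  by apply: GL_groupM => //; rewrite memJ_norm //; apply: GL_groupV.
have bf : GLval b *m f = f.
  have E : (1%:M + f' *m u') *m f = f by rewrite mulmxDl mul1mx -mulmxA u'f mulmx0 addr0.
  by rewrite Eb -mulmxA E mulmxBl mul1mx -mulmxA uf mulmx0 subr0.
have bVf : GLval b^-1%g *m f = f by rewrite -{1}bf mulmxA -(@GL_MxE 3) mulVg mul1mx.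
have ub : u *m GLval b = u + (u *m f') 0 0 *: u'.
  rewrite Eb mulmxA mulmxBr mulmx1 mulmxA uf mul0mx subr0 mulmxDr mulmx1.
  by rewrite mulmxA mul_row_col_row.
have Etb : GLval (t ^ b)%g = 1%:M + f *m (u *m GLval b).
  by rewrite (tv_conjE _ Et) bVf.
rewrite GL_MxE Etv Etb ub; set w := u + _.
rewrite mulmxBl mul1mx (mulmxDr (f *m u)) mulmx1 -(mulmxA f) (mulmxA u) uf.
rewrite mul0mx mulmx0 addr0 -addrA -mulmxBr; congr (_ + _ *m _).
by rewrite /w addrC addKr.
Qed.

(** A scalar matrix of determinant one is given by a cube root of unity, hence trivial. So a
    nontrivial element of N moves some line of row vectors and produces a transvection in N, and
    with it all of them. *)
Lemma tv_group_simple :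
  (forall c : F, c ^+ 3 = 1 -> c = 1) -> simple tv_group.
Proof.
move=> cube1; apply/simpleP; split.
  have uf : (delta_mx 0 1 : 'rV[F]_3) *m (delta_mx 0 0 : 'cV[F]_3) = 0.
    by rewrite mul_delta_mx_0.
  apply/trivgPn; have [a Ta Ea] := has_tv_group uf; exists a => //.
  apply/eqP => a1; move: Ea; rewrite a1 => /matrixP/(_ 0 1).
  rewrite mul_delta_mx !mxE /= mulr0n add0r => /eqP.
  by rewrite eq_sym oner_eq0.
move=> N /andP[sN nN].
have [->|/trivgPn[a Na a1]] := eqsVneq N 1%g; [by left|right].
have [u au] : exists u : 'rV[F]_3, ~~ (u *m GLval a <= u)%MS.
  apply: contrapT => /forallNP stab.
  have /row_stable_scalar Ea u : (u *m GLval a <= u)%MS by apply/negPn/negP/stab.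
  have := tv_group_det (fintype.subsetP sN _ Na); rewrite Ea det_scalar => /cube1 E.
  by case/eqP: a1; apply: val_inj; rewrite [LHS]Ea E.
have [f [v [vf f0 v0 Nfv]]] := normal_has_tv nN Na au.
apply/eqP; rewrite finset.eqEsubset sN /=; apply: tv_group_sub => g w.
exact: has_tv_normal_all nN vf f0 v0 Nfv g w.
Qed.

End Transvections.

(** * Burau matrices *)

Section BurauMatrices.
Import GRing.Theory.
Local Open Scope ring_scope.
Variables (R : fieldType) (h : R).
Hypotheses (hh : h * h = h + 1) (five0 : 5 != 0 :> R).

Definition mx3 (a b c d e f g i j : R) : 'M[R]_3 :=
  \matrix_(k, l) nth 0 (nth [::] [:: [:: a; b; c]; [:: d; e; f]; [:: g; i; j]] k) l.
Definition row3 (a b c : R) : 'rV[R]_3 := \row_l nth 0 [:: a; b; c] l.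
Definition col3 (a b c : R) : 'cV[R]_3 := \col_k nth 0 [:: a; b; c] k.

Lemma mx3_mul a b c d e f g i j a' b' c' d' e' f' g' i' j' :
  mx3 a b c d e f g i j *m mx3 a' b' c' d' e' f' g' i' j' =
  mx3 (a * a' + b * d' + c * g') (a * b' + b * e' + c * i') (a * c' + b * f' + c * j')
      (d * a' + e * d' + f * g') (d * b' + e * e' + f * i') (d * c' + e * f' + f * j')
      (g * a' + i * d' + j * g') (g * b' + i * e' + j * i') (g * c' + i * f' + j * j').
Proof.
by apply/matrixP; do 2 (case=> [[|[|[|//]]] ?]);
  rewrite !mxE !big_ord_recl big_ord0 !mxE /= addr0 addrA.
Qed.

Lemma mx3_1 : 1%:M = mx3 1 0 0 0 1 0 0 0 1.
Proof. by apply/matrixP; do 2 (case=> [[|[|[|//]]] ?]); rewrite !mxE. Qed.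

Lemma mx3_tr a b c d e f g i j : (mx3 a b c d e f g i j)^T = mx3 a d g b e i c f j.
Proof. by apply/matrixP; do 2 (case=> [[|[|[|//]]] ?]); rewrite !mxE. Qed.

Lemma col3_row3 a b c a' b' c' : 1%:M + col3 a b c *m row3 a' b' c' =
  mx3 (1 + a * a') (a * b') (a * c') (b * a') (1 + b * b') (b * c') (c * a') (c * b') (1 + c * c').
Proof.
by apply/matrixP; do 2 (case=> [[|[|[|//]]] ?]);
  rewrite !mxE big_ord1 !mxE /= ?add0r.
Qed.

Lemma row3_col3 a b c a' b' c' : (row3 a b c *m col3 a' b' c') 0 0 = a * a' + b * b' + c * c'.
Proof. by rewrite mxE !big_ord_recl big_ord0 !mxE /= addr0 addrA. Qed.

Lemma row3_mx3 x y z a b c d e f g i j : row3 x y z *m mx3 a b c d e f g i j =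
  row3 (x * a + y * d + z * g) (x * b + y * e + z * i) (x * c + y * f + z * j).
Proof.
by apply/rowP; case=> [[|[|[|//]]] ?];
  rewrite !mxE !big_ord_recl big_ord0 !mxE /= addr0 addrA.
Qed.

(* The reduced Burau representation of B_4 at t = h + 1, in a basis where s1 and
   s3 are diagonal. *)
Definition burau1 := mx3 (- (h + 1)) 0 0 0 1 0 0 0 1.
Definition burau1V := mx3 (h - 2) 0 0 0 1 0 0 0 1.
Definition burau3 := mx3 1 0 0 0 (- (h + 1)) 0 0 0 1.
Definition burau3V := mx3 1 0 0 0 (h - 2) 0 0 0 1.
(** The pseudo-reflection 1 - k c r with c = (1, 1, 1)^T and r = (1, 1, 3). As r c = 5, its
    nontrivial eigenvalue is 1 - 5 k = -(h + 1), that of [burau1]. *)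
Definition burau2 := let k := (h + 2) / 5 in
  mx3 (1 - k) (- k) (- 3 * k) (- k) (1 - k) (- 3 * k) (- k) (- k) (1 - 3 * k).
Definition burau2V := let k := (3 - h) / 5 in
  mx3 (1 - k) (- k) (- 3 * k) (- k) (1 - k) (- 3 * k) (- k) (- k) (1 - 3 * k).

Ltac mx3_ring :=
  cbv zeta; rewrite ?col3_row3 ?mx3_1 ?mx3_mul; congr mx3;
  field: hh; rewrite ?five0 //.

Lemma burau1_inv : burau1 *m burau1V = 1%:M. Proof. rewrite /burau1 /burau1V; mx3_ring. Qed.
Lemma burau3_inv : burau3 *m burau3V = 1%:M. Proof. rewrite /burau3 /burau3V; mx3_ring. Qed.
Lemma burau13 : burau1 *m burau3 = burau3 *m burau1.
Proof. rewrite /burau1 /burau3; mx3_ring. Qed.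
Lemma burau2_inv : burau2 *m burau2V = 1%:M. Proof. rewrite /burau2 /burau2V; mx3_ring. Qed.
Lemma burau121 : burau1 *m burau2 *m burau1 = burau2 *m burau1 *m burau2.
Proof. rewrite /burau1 /burau2; mx3_ring. Qed.
Lemma burau323 : burau3 *m burau2 *m burau3 = burau2 *m burau3 *m burau2.
Proof. rewrite /burau3 /burau2; mx3_ring. Qed.

Lemma mx3_col3 x y z a b c d e f g i j : mx3 a b c d e f g i j *m col3 x y z =
  col3 (a * x + b * y + c * z) (d * x + e * y + f * z) (g * x + i * y + j * z).
Proof.
by apply/colP; case=> [[|[|[|//]]] ?];
  rewrite !mxE !big_ord_recl big_ord0 !mxE /= addr0 addrA.
Qed.

Lemma row3Z k x y z : k *: row3 x y z = row3 (k * x) (k * y) (k * z).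
Proof. by apply/rowP; case=> [[|[|[|//]]] ?]; rewrite !mxE. Qed.

Lemma row3D x y z x' y' z' : row3 x y z + row3 x' y' z' = row3 (x + x') (y + y') (z + z').
Proof. by apply/rowP; case=> [[|[|[|//]]] ?]; rewrite !mxE. Qed.

Lemma col3Z k x y z : k *: col3 x y z = col3 (k * x) (k * y) (k * z).
Proof. by apply/colP; case=> [[|[|[|//]]] ?]; rewrite !mxE. Qed.

Lemma col3D x y z x' y' z' : col3 x y z + col3 x' y' z' = col3 (x + x') (y + y') (z + z').
Proof. by apply/colP; case=> [[|[|[|//]]] ?]; rewrite !mxE. Qed.

Lemma row3_ex u : exists x y z, u = row3 x y z.
Proof.
exists (u 0 0), (u 0 1), (u 0 ord_max).
by apply/rowP; case=> [[|[|[|//]]] ?]; rewrite !mxE /=; congr (u _ _); apply: val_inj.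
Qed.

Lemma col3_ex f : exists x y z, f = col3 x y z.
Proof.
exists (f 0 0), (f 1 0), (f ord_max 0).
by apply/colP; case=> [[|[|[|//]]] ?]; rewrite !mxE /=; congr (f _ _); apply: val_inj.
Qed.

(** The eigenvalues of s1 s2^-1 are 1, -1, -1: it fixes a vector, has determinant 1, and h^2 = h + 1
    makes its trace -1. Its square is therefore unipotent. *)
Lemma burau12_square : let k := (1 - 2 * h) / 5 in
  burau1 *m burau2V *m (burau1 *m burau2V) =
  1%:M + col3 (k * (2 * h)) k k *m row3 (2 - 2 * h) 1 3.
Proof. rewrite /burau1 /burau2V; mx3_ring. Qed.

Lemma burau32_square : let k := (1 - 2 * h) / 5 in
  burau3 *m burau2V *m (burau3 *m burau2V) =
  1%:M + col3 k (k * (2 * h)) k *m row3 1 (2 - 2 * h) 3.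
Proof. rewrite /burau3 /burau2V; mx3_ring. Qed.

Let elem12 c := 1%:M + col3 1 0 0 *m row3 0 c 0.
Let elem21 c := 1%:M + col3 0 1 0 *m row3 c 0 0.

(** With d = -(h + 1) and 1/d = h - 2, this is the usual factorisation of diag(d, 1/d) in SL_2 into
    elementary matrices; it places a = s1 s3^-1 in [tv_group]. *)
Lemma burau1_3V : burau1 *m burau3V =
  elem12 (- (h + 1)) *m elem21 (2 - h) *m elem12 (- (h + 2)) *m elem21 1 *m elem12 (- 1).
Proof. rewrite /burau1 /burau3V /elem12 /elem21; mx3_ring. Qed.

(* For J this form, g |-> J^-1 g^-T J inverts the three Burau matrices. *)
Definition burau_form := mx3 1 0 0 0 1 0 0 0 3.

Lemma burau1_form : burau1V^T *m burau_form = burau_form *m burau1V.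
Proof. rewrite /burau1V /burau_form mx3_tr; mx3_ring. Qed.
Lemma burau2_form : burau2V^T *m burau_form = burau_form *m burau2V.
Proof. rewrite /burau2V /burau_form mx3_tr; mx3_ring. Qed.
Lemma burau3_form : burau3V^T *m burau_form = burau_form *m burau3V.
Proof. rewrite /burau3V /burau_form mx3_tr; mx3_ring. Qed.

Lemma burau_form_unit : 3 != 0 :> R -> burau_form *m mx3 1 0 0 0 1 0 0 0 3^-1 = 1%:M.
Proof.
move=> three0; rewrite /burau_form mx3_1 mx3_mul; congr mx3; field; rewrite ?three0 //.
Qed.

End BurauMatrices.

(** * Finite simple quotients *)

Section FiniteGenerated.
Local Open Scope group_scope.
Variables (gT : finGroupType) (a b : gT).
Local Notation phi := (free_lift (pair_fun a b)).

Lemma gen2_image g : g \in <<[set a; b]>> -> exists z, phi z = g.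
Proof.
pose Im := [set g : gT | `[< exists z, phi z = g >]].
have grIm : group_set Im.
  apply/group_setP; split=> [|x y]; rewrite !inE.
    by exists 1; rewrite mult1.
  move=> [z <-] [z' <-].
  by exists (z * z'); rewrite gmulfM.
move=> gG; suff /fintype.subsetP/(_ g gG) : <<[set a; b]>> \subset Group grIm.
  by rewrite !inE.
rewrite gen_subG; apply/fintype.subsetP => x.
rewrite !inE => /orP[]/eqP->.
  by exists free_x; apply: free_lift_x.
by exists free_y; apply: free_lift_y.
Qed.

Lemma free_lift_gen2 z : phi z \in <<[set a; b]>>.
Proof.
rewrite /free_lift /word_lift; elim: (free_word z) => [|[i e] w IH].
  by rewrite big_nil group1.
rewrite big_cons groupM // /letter_lift /pair_fun /=.
have Gi : (if i == ord0 then a else b) \in <<[set a; b]>>.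
  by case: ifP => _; rewrite mem_gen // !inE eqxx ?orbT.
by case: e; rewrite ?groupV.
Qed.

Lemma gen2_norm s : a ^ s^-1 \in <<[set a; b]>> -> b ^ s^-1 \in <<[set a; b]>> ->
  s \in 'N(<<[set a; b]>>).
Proof.
move=> Gas Gbs; rewrite -groupV inE -genJ gen_subG.
by apply/fintype.subsetP => _ /imsetP[x + ->]; rewrite !inE => /orP[]/eqP->.
Qed.

(** The first isomorphism theorem, the map being defined on coset representatives. The target
    [subg_of G] turns the generated subgroup into a finite group type of its own. *)
Lemma gen2_quotient (nN : normal_subgroup [set z | phi z = 1]%classic) :
  simple <<[set a; b]>> -> finite_simple_group (quot_group nN).
Proof.
move=> simG; pose G := <<[set a; b]>>%G.
pose q : {multiplicative 'Free_2 -> quot_group nN} := quot_pi nN.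
pose f (c : quot_group nN) : subg_of G := subg G (phi (generic_quotient.repr c)).
have mulVE (H : groupType) (g : {multiplicative 'Free_2 -> H}) x y :
    g (x^-1 * y) = 1 <-> g x = g y.
  rewrite gmulfM multV; split=> [E|->]; last by rewrite mulVg.
  by rewrite -[RHS](mulKVg (g x)) E mulg1.
have qP x y : q x = q y <-> phi x = phi y.
  split=> [/mulVE/quot_pi_ker/mulVE|] // E.
  by apply/mulVE/quot_pi_ker/(mulVE _ (free_lift (pair_fun a b))).
have fE x : f (q x) = subg G (phi x).
  by rewrite /f; congr (subg _ _); apply/qP; apply: (@generic_quotient.reprK _ (quot_group nN)).
have fM : {morph f : c d / c * d}.
  move=> c d; have [x <-] := quot_pi_surj c; have [y <-] := quot_pi_surj d.
  rewrite -/(q x) -/(q y) -gmulfM !fE gmulfM; apply: val_inj.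
  by rewrite /= !subgK ?groupM // free_lift_gen2.
have f_surj g : exists c, f c = g.
  have [z Ez] := gen2_image (valP g).
  by exists (q z); rewrite fE Ez sgvalK.
have f_inj : injective f.
  move=> c d; have [x <-] := quot_pi_surj c; have [y <-] := quot_pi_surj d.
  rewrite -/(q x) -/(q y) !fE => /(congr1 val).
  by rewrite /= !subgK ?free_lift_gen2 // => /qP.
have [f' f'K] := choice f_surj.
have [F FE] := multiplicative_exists fM.
exists (subg_of G); split; first by rewrite -(isog_simple (isog_subg G)).
by exists F; exists f' => c; rewrite FE //; apply: f_inj; rewrite f'K.
Qed.

End FiniteGenerated.

Section FiniteSimpleQuotients.
Local Open Scope group_scope.

(** Serves to tell quotients apart: finitely many of them have a common exponent. *)
Lemma finite_simple_exponent (H : groupType) : finite_simple_group H ->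
  exists2 n, (0 < n)%N & forall x : H, x ^+ n = 1.
Proof.
case=> gT [_ [f [g fK _]]]; exists #|[set: gT]|; first exact: cardG_gt0.
move=> x; apply: (can_inj fK); rewrite mult1.
have -> n : f (x ^+ n) = f x ^+ n by elim: n => [|n IH]; rewrite ?mult1 // !expgS gmulfM IH.
by apply: expg_cardG; rewrite inE.
Qed.

Lemma finite_simple_finite_index (G : groupType) (N : set G) (nN : normal_subgroup N) :
  finite_simple_group (quot_group nN) -> finite_index N.
Proof.
case=> gT [_ [f [g fK _]]]; rewrite /finite_index.
pose coset_of_quot (c : quot_group nN) : set G := [set z | quot_pi nN z = c]%classic.
apply: (@sub_finite_set _ _ (range (fun c : gT => coset_of_quot (g c)))); last first.
  exact/finite_image/finite_finset.
move=> _ [x _ <-]; exists (f (quot_pi nN x)) => //; rewrite fK.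
pose q : {multiplicative G -> quot_group nN} := quot_pi nN.
apply/seteqP; split=> z /=.
  move=> E; exists (x^-1 * z); last by rewrite mulKVg.
  apply/(quot_pi_ker nN); transitivity ((q x)^-1 * q z); last by rewrite (E : q z = q x) mulVg.
  by rewrite -multV -gmulfM.
case=> y /(quot_pi_ker nN) y1 <-; transitivity (q x * q y); first exact: gmulfM.
by rewrite (y1 : q y = 1) mulg1.
Qed.

End FiniteSimpleQuotients.

(** The conjugation formulas show that s1, s2, s3 normalise the subgroup generated by a and b; hence
    T does, and a nontrivial normal subgroup of the simple group T is T. *)
Lemma braid_gen_simple (gT : finGroupType) (s1 s2 s3 : gT) (T : {group gT}) :
  (s1 * s2 * s1 = s2 * s1 * s2)%g -> (s3 * s2 * s3 = s2 * s3 * s2)%g ->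
  (s1 * s3 = s3 * s1)%g -> simple T -> braid_a s1 s3 \in T -> braid_a s1 s3 != 1%g ->
  s2 \in 'N(T)%g ->
  (forall H : {group gT}, s1 \in H -> s2 \in H -> s3 \in H -> T \subset H) ->
  <<[set braid_a s1 s3; braid_b s1 s2 s3]>>%g = T.
Proof.
set a := braid_a s1 s3; set b := braid_b s1 s2 s3 => s121 s323 s13 simT Ta a1 nTs2 subT.
pose G := <<[set a; b]>>%G.
have Ga : a \in G by rewrite mem_gen // !inE eqxx.
have Gb : b \in G by rewrite mem_gen // !inE eqxx orbT.
have Tb : b \in T by rewrite -[b]braid_a_conj2 memJ_norm // groupV.
have sG : G \subset T.
  by rewrite gen_subG; apply/fintype.subsetP => x; rewrite !inE => /orP[]/eqP->.
have nG : T \subset 'N(G)%g.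
  apply: subT; apply: gen2_norm.
  - by rewrite braid_a_conj1.
  - by rewrite braid_b_conj1 // groupM // groupV.
  - by rewrite braid_a_conj2.
  - by rewrite braid_b_conj2 // groupM // groupM // groupV.
  - by rewrite braid_a_conj3.
  by rewrite braid_b_conj3 // groupM // groupV.
have /simpleP[_ /(_ G)] := simT.
rewrite /normal sG nG => /(_ isT)[] // G1.
by move: Ga; rewrite G1 inE (negPf a1).
Qed.

(** * From braid triples to characteristic simple quotients *)

Section BraidQuotient.
Local Open Scope group_scope.

Definition simple_char_quotient (N : set 'Free_2) :=
  exists charN : characteristic_subgroup N,
    finite_simple_group (quot_group (characteristic_normal charN)).

(** N is the kernel of the map given by (a, b). The last clause transfers exponents from the
    quotient to T, where they can be computed. *)
Lemma braid_simple_quotient (gT : finGroupType) (s1 s2 s3 : gT) (T : {group gT})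
    (theta : {multiplicative gT -> gT}) :
  s1 * s2 * s1 = s2 * s1 * s2 -> s3 * s2 * s3 = s2 * s3 * s2 -> s1 * s3 = s3 * s1 ->
  injective theta -> theta s1 = s1^-1 -> theta s2 = s2^-1 -> theta s3 = s3^-1 ->
  simple T -> s2 \in 'N(T) -> s1 * s3^-1 \in T -> s1 != s3 ->
  (forall H : {group gT}, s1 \in H -> s2 \in H -> s3 \in H -> T \subset H) ->
  exists2 N, simple_char_quotient N &
    forall D, (forall z, N (z ^+ D)) -> forall g, g \in T -> g ^+ D = 1.
Proof.
move=> s121 s323 s13 inj t1 t2 t3 simT nTs2 Ta s1s3 subT.
have a1 : braid_a s1 s3 != 1.
  by apply: contraNneq s1s3 => a1; rewrite -[s1](mulgVK s3) -/(braid_a s1 s3) a1 mul1g.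
have gen := braid_gen_simple s121 s323 s13 simT Ta a1 nTs2 subT.
have charN := braid_kernel_characteristic s121 s323 s13 inj t1 t2 t3.
exists [set z | braid_lift s1 s2 s3 z = 1]%classic.
  by exists charN; apply: gen2_quotient; rewrite gen.
move=> D ND g; rewrite -gen => /gen2_image[z <-]; rewrite -[RHS](ND z) /=.
by elim: D {ND} => [|D IH]; rewrite ?mult1 // !expgS IH; apply/esym/free_liftM.
Qed.

Lemma GL_braid_simple_quotient (R : finComUnitRingType) n (s1 s2 s3 : {'GL_n[R]})
    (T : {group {'GL_n[R]}}) (theta : {multiplicative {'GL_n[R]} -> {'GL_n[R]}}) :
  s1 * s2 * s1 = s2 * s1 * s2 -> s3 * s2 * s3 = s2 * s3 * s2 -> s1 * s3 = s3 * s1 ->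
  injective theta -> theta s1 = s1^-1 -> theta s2 = s2^-1 -> theta s3 = s3^-1 ->
  simple T -> s2 \in 'N(T) -> s1 * s3^-1 \in T -> s1 != s3 ->
  (forall H : {group {'GL_n[R]}}, s1 \in H -> s2 \in H -> s3 \in H -> T \subset H) ->
  exists2 N, simple_char_quotient N &
    forall D, (forall z, N (z ^+ D)) -> forall g, g \in T -> g ^+ D = 1.
Proof. exact: braid_simple_quotient. Qed.

End BraidQuotient.

(** * The group generated by the Burau matrices *)

Section BurauGroup.
Import GRing.Theory.
Local Open Scope ring_scope.
Variable F : finFieldType.
Hypotheses (F_natr : forall c : F, exists n, c = n%:R) (F_card : #|F|%:R = 0 :> F).
Local Notation GL := {'GL_3[F]}.
Implicit Types (f g : 'cV[F]_3) (u v w : 'rV[F]_3) (H : {group GL}).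
Variable h : F.
Hypotheses (hh : h * h = h + 1) (two0 : 2 != 0 :> F) (three0 : 3 != 0 :> F)
  (five0 : 5 != 0 :> F).
Variables (s1 s2 s3 : GL).
Hypotheses (s1E : GLval s1 = burau1 h) (s2E : GLval s2 = burau2 h)
  (s3E : GLval s3 = burau3 h).

Let s1VE : GLval s1^-1%g = burau1V h.
Proof. by apply: GL_inv_val; rewrite s1E burau1_inv. Qed.
Let s2VE : GLval s2^-1%g = burau2V h.
Proof. by apply: GL_inv_val; rewrite s2E burau2_inv. Qed.
Let s3VE : GLval s3^-1%g = burau3V h.
Proof. by apply: GL_inv_val; rewrite s3E burau3_inv. Qed.

Lemma burau_s121 : (s1 * s2 * s1 = s2 * s1 * s2)%g.
Proof. by apply: GL_inj; rewrite !GL_MxE s1E s2E; apply: burau121. Qed.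

Lemma burau_s323 : (s3 * s2 * s3 = s2 * s3 * s2)%g.
Proof. by apply: GL_inj; rewrite !GL_MxE s3E s2E; apply: burau323. Qed.

Lemma burau_s13 : (s1 * s3 = s3 * s1)%g.
Proof. by apply: GL_inj; rewrite !GL_MxE s3E s1E; apply: burau13. Qed.

Lemma burau_theta : exists theta : {multiplicative GL -> GL},
  [/\ injective theta, theta s1 = s1^-1%g, theta s2 = s2^-1%g & theta s3 = s3^-1%g].
Proof.
have [J EJ] := GL_exists (burau_form_unit three0).
have trP (g : GL) : (GLval g)^T \in unitmx by rewrite unitmx_tr; apply: GL_unit.
pose tr (g : GL) : GL := FinRing.unit 'M[F]_3 (trP g).
have trE (g : GL) : GLval (tr g) = (GLval g)^T by [].
have trM (x y : GL) : tr (x * y)%g = (tr y * tr x)%g.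
  by apply: GL_inj; rewrite GL_MxE !trE GL_MxE trmx_mul.
have [theta thetaE] : exists theta : {multiplicative GL -> GL},
    theta =1 (fun g : GL => (tr g^-1) ^ J)%g.
  by apply: multiplicative_exists => x y; rewrite invMg trM conjMg.
exists theta.
have inv (s : GL) : (GLval s^-1%g)^T *m burau_form F = burau_form F *m GLval s^-1%g ->
    theta s = s^-1%g.
  move=> E; rewrite thetaE; apply/(mulgI J); rewrite -conjgC; apply: GL_inj.
  by rewrite !GL_MxE trE EJ.
split.
- move=> x y; rewrite !thetaE => /conjg_inj/(congr1 (@GLval _ _)).
  by rewrite !trE => /trmx_inj H; apply/invg_inj/GL_inj.
- by apply: inv; rewrite s1VE burau1_form.
- by apply: inv; rewrite s2VE burau2_form.
by apply: inv; rewrite s3VE burau3_form.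
Qed.

Lemma braid_a_tv : braid_a s1 s3 \in tv_group F.
Proof.
have elem f u : u *m f = 0 -> exists2 g, g \in tv_group F & GLval g = 1%:M + f *m u.
  exact: has_tv_group.
have zero (a b c a' b' c' : F) : a * a' + b * b' + c * c' = 0 ->
    row3 a b c *m col3 a' b' c' = 0.
  by move=> E; apply/eqP; rewrite row_col_eq0 row3_col3 E.
have e12 c : exists2 g, g \in tv_group F & GLval g = 1%:M + col3 1 0 0 *m row3 0 c 0.
  by apply: elem; apply: zero; rewrite !(mul0r, mulr0, addr0).
have e21 c : exists2 g, g \in tv_group F & GLval g = 1%:M + col3 0 1 0 *m row3 c 0 0.
  by apply: elem; apply: zero; rewrite !(mul0r, mulr0, addr0).
have [g1 T1 E1] := e12 (- (h + 1)); have [g2 T2 E2] := e21 (2 - h).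
have [g3 T3 E3] := e12 (- (h + 2)); have [g4 T4 E4] := e21 1.
have [g5 T5 E5] := e12 (- 1).
have -> : braid_a s1 s3 = (g1 * g2 * g3 * g4 * g5)%g.
  apply: GL_inj; rewrite !GL_MxE s1E s3VE E1 E2 E3 E4 E5.
  exact: burau1_3V.
exact: (GL_groupM (GL_groupM (GL_groupM (GL_groupM T1 T2) T3) T4) T5).
Qed.

Let h2 : h + 2 != 0.
Proof.
have E : (h + 2) * (3 - h) / 5 = 1 by field: hh; rewrite ?five0.
by apply: contraTneq isT => e0; move: E; rewrite e0 !mul0r => /eqP; rewrite eq_sym oner_eq0.
Qed.

Section Generation.
Variable H : {group GL}.
Hypotheses (Hs1 : s1 \in H) (Hs2 : s2 \in H) (Hs3 : s3 \in H).

Let k : F := (1 - 2 * h) / 5.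

Let k0 : k != 0.
Proof.
have E : k * (1 - 2 * h) = 1 by rewrite /k; field: hh; rewrite ?five0.
by apply: contraTneq isT => k0; move: E; rewrite k0 mul0r => /eqP; rewrite eq_sym oner_eq0.
Qed.

Let W1 f := exists x y, f = col3 (x + y) y y.
Let W3 f := exists x y, f = col3 y (x + y) y.

(** [W1] is a plane stable under s1, and its intersection with the kernel of u0 is the line of f0,
    so the transvection (s1 s2^-1)^2 makes u0 full for [W1]. Conjugation by s1 makes (2h, 1, 3)
    full. The sum of the two functionals is twice (1, 1, 3). *)
Let full_w1 : full_vector H W1 (row3 1 1 3).
Proof.
have W_lin f g c : W1 f -> W1 g -> W1 (f + c *: g).
  move=> [x [y ->]] [x' [y' ->]]; exists (x + c * x'), (y + c * y').
  by rewrite col3Z col3D mulrDr addrACA.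
have W_scale f c : W1 f -> W1 (c *: f).
  by move=> [x [y ->]]; exists (c * x), (c * y); rewrite col3Z mulrDr.
pose u0 : 'rV[F]_3 := row3 (2 - 2 * h) 1 3.
pose f0 : 'cV[F]_3 := col3 (k * (2 * h)) k k.
have u0f0 : u0 *m f0 = 0.
  apply/eqP; rewrite row_col_eq0 row3_col3; apply/eqP; ring: hh.
have Hu0 : has_tv H f0 u0.
  have Hss : (s1 * s2^-1)%g \in H := GL_groupM Hs1 (GL_groupV Hs2).
  exists ((s1 * s2^-1) * (s1 * s2^-1))%g; first exact: (GL_groupM Hss Hss).
  by rewrite !GL_MxE s1E s2VE burau12_square.
have full0 : full_vector H W1 u0.
  move=> _ [x [y ->]] /eqP; rewrite row_col_eq0 row3_col3 => /eqP E.
  have Exy : x + y = 2 * h * y.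
    apply: (mulfI two0); apply/eqP; rewrite -subr_eq0; apply/eqP.
    (* Since -h (2 - 2h) = 2, multiplying the equation [E] by -h gives 2 (x + y) - 4 h y. *)
    transitivity (- h * ((2 - 2 * h) * (x + y) + 1 * y + 3 * y)); first by ring: hh.
    by rewrite E mulr0.
  have -> : col3 (x + y) y y = (y / k) *: f0.
    by rewrite col3Z Exy (mulrA (y / k) k) divfK ?k0 // (mulrC y).
  exact: has_tvZl.
have s1W f : W1 f -> W1 (GLval s1 *m f).
  move=> [x [y ->]]; exists (- (h + 1) * (x + y) - y), y.
  by rewrite s1E mx3_col3; congr col3; ring.
have full1 : full_vector H W1 (u0 *m GLval s1).
  exact: full_vector_conj (fintype.subsetP (normG H) _ Hs1) s1W full0.
have E : u0 *m GLval s1 = row3 (2 * h) 1 3.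
  by rewrite s1E row3_mx3; congr row3; ring: hh.
have Wf0 : W1 f0 by exists (k * (2 * h) - k), k; rewrite /f0 subrK.
have nz : u0 *m GLval s1 *m f0 != 0.
  rewrite row_col_eq0 E row3_col3.
  have -> : 2 * h * (k * (2 * h)) + 1 * k + 3 * k = 2 * 2 * (k * (h + 2)) by ring: hh.
  exact: mulf_neq0 (mulf_neq0 two0 two0) (mulf_neq0 k0 h2).
have := full_vector_add W_lin W_scale (c := 1) Wf0 u0f0 nz full0 full1.
move/(full_vectorZ F_natr (c := 1 / 2)).
rewrite E scale1r row3D row3Z.
by congr (full_vector _ _ _); congr row3; field; rewrite ?two0.
Qed.

Let full_w3 : full_vector H W3 (row3 1 1 3).
Proof.
have W_lin f g c : W3 f -> W3 g -> W3 (f + c *: g).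
  move=> [x [y ->]] [x' [y' ->]]; exists (x + c * x'), (y + c * y').
  by rewrite col3Z col3D mulrDr addrACA.
have W_scale f c : W3 f -> W3 (c *: f).
  by move=> [x [y ->]]; exists (c * x), (c * y); rewrite col3Z mulrDr.
pose u0 : 'rV[F]_3 := row3 1 (2 - 2 * h) 3.
pose f0 : 'cV[F]_3 := col3 k (k * (2 * h)) k.
have u0f0 : u0 *m f0 = 0.
  apply/eqP; rewrite row_col_eq0 row3_col3; apply/eqP; ring: hh.
have Hu0 : has_tv H f0 u0.
  have Hss : (s3 * s2^-1)%g \in H := GL_groupM Hs3 (GL_groupV Hs2).
  exists ((s3 * s2^-1) * (s3 * s2^-1))%g; first exact: (GL_groupM Hss Hss).
  by rewrite !GL_MxE s3E s2VE burau32_square.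
have full0 : full_vector H W3 u0.
  move=> _ [x [y ->]] /eqP; rewrite row_col_eq0 row3_col3 => /eqP E.
  have Exy : x + y = 2 * h * y.
    apply: (mulfI two0); apply/eqP; rewrite -subr_eq0; apply/eqP.
    transitivity (- h * (1 * y + (2 - 2 * h) * (x + y) + 3 * y)); first by ring: hh.
    by rewrite E mulr0.
  have -> : col3 y (x + y) y = (y / k) *: f0.
    by rewrite col3Z Exy (mulrA (y / k) k) divfK ?k0 // (mulrC y).
  exact: has_tvZl.
have s3W f : W3 f -> W3 (GLval s3 *m f).
  move=> [x [y ->]]; exists (- (h + 1) * (x + y) - y), y.
  by rewrite s3E mx3_col3; congr col3; ring.
have full1 : full_vector H W3 (u0 *m GLval s3).
  exact: full_vector_conj (fintype.subsetP (normG H) _ Hs3) s3W full0.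
have E : u0 *m GLval s3 = row3 1 (2 * h) 3.
  by rewrite s3E row3_mx3; congr row3; ring: hh.
have Wf0 : W3 f0 by exists (k * (2 * h) - k), k; rewrite /f0 subrK.
have nz : u0 *m GLval s3 *m f0 != 0.
  rewrite row_col_eq0 E row3_col3.
  have -> : 1 * k + 2 * h * (k * (2 * h)) + 3 * k = 2 * 2 * (k * (h + 2)) by ring: hh.
  exact: mulf_neq0 (mulf_neq0 two0 two0) (mulf_neq0 k0 h2).
have := full_vector_add W_lin W_scale (c := 1) Wf0 u0f0 nz full0 full1.
move/(full_vectorZ F_natr (c := 1 / 2)).
rewrite E scale1r row3D row3Z.
by congr (full_vector _ _ _); congr row3; field; rewrite ?two0.
Qed.

(** The kernel of (1, 1, 3) is spanned by (-4, 1, 1)^T, which lies in [W1], and (1, -4, 1)^T, which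
    lies in [W3]; a and b are the coordinates. *)
Let full_w : full_vector H (fun=> True) (row3 1 1 3).
Proof.
move=> f _; have [x [y [z ->]]] := col3_ex f.
move=> /eqP; rewrite row_col_eq0 row3_col3 => /eqP E.
pose a := (z - x) / 5; pose b := (z - y) / 5.
have -> : col3 x y z = col3 (- 5 * a + a) a a + col3 b (- 5 * b + b) b.
  have Ez : z = a + b.
    apply: (mulfI five0); apply/eqP; rewrite -subr_eq0; apply/eqP.
    transitivity (1 * x + 1 * y + 3 * z); last exact: E.
    by rewrite /a /b; field; rewrite ?five0.
  rewrite col3D -(addrA (- 5 * a)) (addrCA a) -Ez.
  by congr col3; rewrite /a /b; field; rewrite ?five0.
apply: has_tvDl.
- by apply/eqP; rewrite row_col_eq0 row3_col3; apply/eqP; ring.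
- apply: full_w1; first by exists (- 5 * a), a.
  by apply/eqP; rewrite row_col_eq0 row3_col3; apply/eqP; ring.
apply: full_w3; first by exists (- 5 * b), b.
by apply/eqP; rewrite row_col_eq0 row3_col3; apply/eqP; ring.
Qed.

(** Applying s1 - 1 and s3 - 1 to the row (1, 1, 3) gives multiples of the first two basis rows by
    -(h + 2), which is nonzero. As 3 is invertible, these rows and (1, 1, 3) span everything. *)
Lemma burau_full u : full_vector H (fun=> True) u.
Proof.
have full_s (s : GL) : s \in H -> full_vector H (fun=> True) (row3 1 1 3 *m GLval s).
  by move=> Hs; apply: full_vector_conj (fintype.subsetP (normG H) _ Hs) _ full_w.
have full_x x : full_vector H (fun=> True) (row3 x 0 0).
  have -> : row3 x 0 0 = (- x / (h + 2)) *: (row3 1 1 3 *m GLval s1 + (- 1) *: row3 1 1 3).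
    by rewrite s1E row3_mx3 !row3Z row3D row3Z; congr row3; field; rewrite ?h2.
  by apply: full_vectorZ => //; apply: full_vectorD => //; apply: full_s.
have full_y y : full_vector H (fun=> True) (row3 0 y 0).
  have -> : row3 0 y 0 = (- y / (h + 2)) *: (row3 1 1 3 *m GLval s3 + (- 1) *: row3 1 1 3).
    by rewrite s3E row3_mx3 !row3Z row3D row3Z; congr row3; field; rewrite ?h2.
  by apply: full_vectorZ => //; apply: full_vectorD => //; apply: full_s.
have [x [y [z ->]]] := row3_ex u.
have -> : row3 x y z = row3 0 (y - z / 3) 0 + 1 *: row3 (x - z / 3) 0 0 + (z / 3) *: row3 1 1 3.
  by rewrite !row3Z !row3D; congr row3; field; rewrite ?three0.
by apply: full_vectorD => //; apply: full_vectorD.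
Qed.

Lemma tv_group_sub_burau : tv_group F \subset H.
Proof. by apply: tv_group_sub => f u; apply: burau_full. Qed.

End Generation.

Hypothesis F_cube : forall c : F, c ^+ 3 = 1 -> c = 1.

Lemma burau_simple_quotient : exists2 N, simple_char_quotient N &
  forall D, (forall z, N (z ^+ D)%g) -> D%:R = 0 :> F.
Proof.
have [theta [inj t1 t2 t3]] := burau_theta.
have s1s3 : s1 != s3.
  apply: contraNneq h2 => s13; have := s1E; rewrite s13 s3E => /matrixP/(_ 0 0).
  rewrite !mxE /= => E; apply/eqP; transitivity (1 - - (h + 1)); first by ring.
  by rewrite -E subrr.
have simT := tv_group_simple F_natr F_card F_cube.
have [N charN ND] := GL_braid_simple_quotient burau_s121 burau_s323 burau_s13
  inj t1 t2 t3 simT (tv_group_norm s2) braid_a_tv s1s3 tv_group_sub_burau.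
exists N => // D /ND powD.
have uf : (delta_mx 0 1 : 'rV[F]_3) *m (delta_mx 0 0 : 'cV[F]_3) = 0.
  by rewrite mul_delta_mx_0.
have [g Tg Eg] := has_tv_group uf.
(* The D-th power of a nontrivial transvection is trivial only if D vanishes in F. *)
have := tv_expg D uf Eg; rewrite powD // => /matrixP/(_ 0 1).
by rewrite -scalemxAr mul_delta_mx !mxE /= mulr0n mulr1 add0r => ->.
Qed.

End BurauGroup.

(** * Infinitely many primes *)

(** If the least prime factor is not 2 mod 3, it is 1 mod 3, so the cofactor is again 2 mod 3. *)
Lemma prime_factor_2mod3 m : m %% 3 = 2 -> exists q, [/\ prime q, q %| m & q %% 3 = 2].
Proof.
have [k] := ubnP m; elim: k m => // k IH m le_m m3.
have m1 : 1 < m by case: m m3 {le_m} => [|[|]].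
have pr := pdiv_prime m1; have qm := pdiv_dvd m.
have [q2|q2] := eqVneq (pdiv m %% 3) 2; first by exists (pdiv m).
have E : (m %/ pdiv m) * pdiv m = m by rewrite divnK.
have q_gt1 := prime_gt1 pr.
have m'3 : (m %/ pdiv m) %% 3 = 2.
  have := ltn_pmod (pdiv m) (isT : 0 < 3); have := ltn_pmod (m %/ pdiv m) (isT : 0 < 3).
  move: m3; rewrite -{1}E -modnMm.
  by move: (pdiv m %% 3) (m %/ pdiv m %% 3) q2 => [|[|[|?]]] [|[|[|?]]].
have lt_m : m %/ pdiv m < k by apply: leq_trans (ltn_Pdiv q_gt1 _) _; lia.
have [q [prq qd q3]] := IH _ lt_m m'3.
by exists q; split=> //; apply: dvdn_trans qd (dvdn_div qm).
Qed.

(* A prime factor of 5 (n!)^2 - 1 exceeds n, and 5 is a square modulo it. *)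
Lemma prime_sqrt5 n : exists p, [/\ prime p, n < p, p %% 3 = 2 &
  exists y, 5 * y ^ 2 = 1 %[mod p]].
Proof.
(* The shift by 3 makes y divisible by 3, whence m = 2 mod 3. *)
pose y := (n + 3)`!; have y0 : 0 < y by apply: fact_gt0.
have y3 : 3 %| y by apply: dvdn_fact; lia.
pose m := 5 * y ^ 2 - 1.
have Em : m.+1 = 5 * y ^ 2 by rewrite /m subn1 prednK // muln_gt0 expn_gt0 y0.
have m3 : m %% 3 = 2.
  have : m.+1 %% 3 = 0 by apply/eqP; rewrite Em -/(3 %| _) dvdn_mull // dvdn_mulr.
  by lia.
have [p [pr pm p3]] := prime_factor_2mod3 m3.
exists p; split=> //.
  rewrite ltnNge; apply/negP => le.
  have py : p %| y by apply: dvdn_fact; rewrite prime_gt0 //=; lia.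
  have : p %| m.+1 by rewrite Em dvdn_mull // dvdn_mulr.
  by rewrite -addn1 dvdn_addr // Euclid_dvd1.
by exists y; rewrite -Em -addn1; apply/eqP; rewrite -{2}[1]add0n eqn_modDr mod0n.
Qed.

(** * Choice of the field and conclusion *)

Section FieldChoice.
Import GRing.Theory.
Local Open Scope ring_scope.

(** Here 5 y is a square root of 5, and the root is the golden ratio. *)
Lemma golden_root (R : fieldType) (y : R) : 2 != 0 :> R -> 5 * y ^+ 2 = 1 ->
  (1 + 5 * y) / 2 * ((1 + 5 * y) / 2) = (1 + 5 * y) / 2 + 1.
Proof.
move=> two0 yE.
transitivity ((1 + 10 * y + 5 * (5 * y ^+ 2)) / 2 / 2); first by field; rewrite ?two0.
by rewrite yE; field; rewrite ?two0.
Qed.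

(** If c^3 = 1 and |F| = 2 mod 3, then c = c^|F| = c^2. *)
Lemma cube_root1 (F : finFieldType) (c : F) :
  (#|F| %% 3 = 2)%N -> c ^+ 3 = 1 -> c = 1.
Proof.
move=> F3 c3; have c0 : c != 0.
  by apply: contra_eqN c3 => /eqP->; rewrite expr0n eq_sym oner_neq0.
have := expf_card c; rewrite (divn_eq #|F| 3) F3 exprD mulnC exprM c3.
by rewrite expr1n mul1r expr2 -[RHS]mulr1 => /(mulfI c0).
Qed.

Lemma simple_char_quotient_exponent n :
  exists2 N, simple_char_quotient N & forall D, (0 < D <= n)%N -> exists z, ~ N (z ^+ D)%g.
Proof.
(* A prime above n + 5 makes 2, 3, 5 and every positive D up to n nonzero in the field. *)
have [p [pr np p3 [y y5]]] := prime_sqrt5 (n + 5).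
have natr0 k : (k%:R == 0 :> 'F_p) = (p %| k)%N.
  by rewrite (dvdn_pcharf (pchar_Fp pr)).
have nz k : (0 < k <= n + 5)%N -> k%:R != 0 :> 'F_p.
  move=> /andP[k0 kn]; rewrite natr0; apply/negP => /(dvdn_leq k0); lia.
have two0 : 2 != 0 :> 'F_p by apply: (nz 2); lia.
have three0 : 3 != 0 :> 'F_p by apply: (nz 3); lia.
have five0 : 5 != 0 :> 'F_p by apply: (nz 5); lia.
have yE : 5 * y%:R ^+ 2 = 1 :> 'F_p.
  have := congr1 (fun k => k%:R : 'F_p) y5; rewrite !Fp_nat_mod //.
  by rewrite natrM natrX.
pose h : 'F_p := (1 + 5 * y%:R) / 2.
have hh : h * h = h + 1 by apply: golden_root.
have F_natr (c : 'F_p) : exists n, c = n%:R by exists c; rewrite natr_Zp.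
have F_card : #|'F_p|%:R = 0 :> 'F_p by rewrite card_Fp // pchar_Fp_0.
have F_cube (c : 'F_p) : c ^+ 3 = 1 -> c = 1 by apply: cube_root1; rewrite card_Fp.
have [s1 E1] := GL_exists (burau1_inv hh).
have [s2 E2] := GL_exists (burau2_inv hh five0).
have [s3 E3] := GL_exists (burau3_inv hh).
have [N charN ND] := burau_simple_quotient F_natr F_card hh two0 three0 five0 E1 E2 E3 F_cube.
exists N => // D /andP[D0 Dn]; apply/existsNP => /ND/eqP; apply/negP; apply: nz; lia.
Qed.

End FieldChoice.

(** For a finite list, the product D of exponents of the quotients would put every D-th power in
    every N; but some N has a quotient in which no positive integer up to D is an exponent. *)
Lemma infinite_simple_char_quotient : infinite_set [set N | simple_char_quotient N]%classic.
Proof.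
move=> /finite_seqP[s Es].
have [D D0 HD] : exists2 D, (0 < D)%N &
    forall N, N \in s -> simple_char_quotient N -> forall z, N (z ^+ D)%g.
  elim: s {Es} => [|N s [D D0 HD]]; first by exists 1%N.
  have [charN|nN] := pselect (simple_char_quotient N); last first.
    exists D => // M; rewrite in_cons => /orP[/eqP->|/HD] //.
  have [nN fN] := charN; have [e e0 He] := finite_simple_exponent fN.
  exists (D * e)%N; first by rewrite muln_gt0 D0.
  move=> M; rewrite in_cons => /orP[/eqP-> _ z|Ms Mchar z]; last first.
    have -> : (z ^+ (D * e) = (z ^+ e) ^+ D)%g by rewrite mulnC expgM.
    exact: HD.
  apply/(quot_pi_ker (characteristic_normal nN)).
  rewrite expgM -[RHS](He (quot_pi (characteristic_normal nN) (z ^+ D)%g)).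
  by elim: e {e0 He} => [|e IH]; rewrite ?mult1 // !expgS -IH gmulfM.
have [N charN ND] := simple_char_quotient_exponent D.
have [z []] := ND D ltac:(by rewrite D0 leqnn).
apply: HD => //; have : [set N | simple_char_quotient N]%classic N by [].
by rewrite Es.
Qed.

Theorem theorem1p4 :
  infinite_set
    [set N : set 'Free_2 | exists charN : characteristic_subgroup N,
       finite_simple_group (quot_group (characteristic_normal charN))]%classic
  /\ ~ baby_wiegold 2.
Proof.
split; first exact: infinite_simple_char_quotient.
apply; have [N [charN simN] _] := simple_char_quotient_exponent 0.
by exists N, charN; split=> //; apply: finite_simple_finite_index simN.
Qed.
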